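(* Let $Q$ be an LDP-polygon. Then the associated toric log del Pezzo surface $X_Q$ has exactly three singular points if and only if one of the following conditions is satisfied: (1) The Picard number of $X_Q$ is at most two. (2) There exist $p, q, r, s, t \in \mathbb{Z}$ such that $$p \leq 1,$$ $$r \leq \min\{-1, -pq-2, q-pq-1, -pq+qt-rs+ps+t-1\},$$ $$t \leq \min\{-2, -s-1, qt-rs+r-1\},$$ $$2 \leq qt-rs,$$ $\gcd(q, r)=\gcd(s, t)=1$ and $Q$ is equivalent to $$\mathrm{conv}\left\{\begin{pmatrix} 1 \\ 0 \end{pmatrix}, \begin{pmatrix} 0 \\ 1 \end{pmatrix}, \begin{pmatrix} -1 \\ p \end{pmatrix}, \begin{pmatrix} q \\ r \end{pmatrix}, \begin{pmatrix} s \\ t \end{pmatrix}\right\}.$$ (3) $X_Q$ is isomorphic to the blow-up of a toric log del Pezzo surface of Picard number three at one nonsingular $(\mathbb{C}^* )^2$-fixed point. In particular, if $X_Q$ has exactly three singular points, then the Picard number of $X_Q$ is at most four.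
   Context: A convex lattice polygon $Q \subset \mathbb{R}^2$ (vertices in $\mathbb{Z}^2$) is called an LDP-polygon if it contains the origin in its interior and every vertex is a primitive lattice vector. Two LDP-polygons $Q, Q'$ are equivalent if there is a $2\times 2$ unimodular matrix (integer matrix of determinant $\pm 1$) that transforms $Q$ into $Q'$. For an edge $F$ of $Q$ put $\sigma_F=\{\lambda x \mid \lambda \geq 0, x \in F\}\subset\mathbb{R}^2$. The cones $\sigma_F$ and their faces form a complete fan $\Delta_Q$ in $\mathbb{R}^2$, and $X_Q$ denotes the associated complete toric surface over $\mathbb{C}$. A normal projective surface is log del Pezzo if it has at worst log-terminal singularities (that is, quotient singularities) and its anticanonical divisor is a $\mathbb{Q}$-Cartier ample divisor; $X_Q$ is always a toric log del Pezzo surface, and every toric log del Pezzo surface is isomorphic to some $X_Q$. If $v_1,\dots,v_d$ are the vertices of $Q$ in counterclockwise order (with $v_{d+1}=v_1$), the $(\mathbb{C}^* )^2$-fixed points of $X_Q$ correspond to the two-dimensional cones $\mathbb{R}_{\geq 0}v_i+\mathbb{R}_{\geq 0}v_{i+1}$; such a point is nonsingular if and only if $\det(v_i,v_{i+1})=1$, and the singular points of $X_Q$ are the fixed points with $\det(v_i,v_{i+1})\geq 2$. The Picard number of $X_Q$ is $d-2$. The blow-up at a nonsingular fixed point corresponding to the cone $\mathbb{R}_{\geq 0}v_i+\mathbb{R}_{\geq 0}v_{i+1}$ is the toric surface whose fan is obtained by inserting the ray generated by $v_i+v_{i+1}$.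
   Formalization: Conditions (1) and (3) also require exactly three singular points (of X_Q in (1), of the blown-up surface of Picard number three in (3)), since P² and the smooth hexagon surface refute the literal ''if''; toric surfaces are represented by fans, isomorphism by unimodular equivalence of fans. *)

(* Defs.v *)
From mathcomp Require Export all_boot all_order all_algebra.
From mathcomp Require Export finmap.
From mathcomp Require Export all_classical all_reals all_analysis.

Set Implicit Arguments.
Unset Strict Implicit.
Unset Printing Implicit Defensive.

Export Order.TTheory GRing.Theory Num.Theory.
Export numFieldNormedType.Exports.

#[global] Open Scope classical_set_scope.
#[global] Open Scope ring_scope.

(* Toric surfaces are represented by their fans in R^2. Two of them are
   isomorphic as varieties iff their fans correspond under GL_2(Z); that
   criterion is the definition of [toric_isom]. *)

Definition vec2 (x y : int) : 'cV[int]_2 := \col_(i < 2) [:: x; y]`_i.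

Definition det2 (v w : 'cV[int]_2) : int :=
  v ord0 ord0 * w ord_max ord0 - v ord_max ord0 * w ord0 ord0.

Definition primitive (v : 'cV[int]_2) : Prop :=
  gcdz (v ord0 ord0) (v ord_max ord0) = 1.

Section Plane.
Variable R : realType.
Implicit Types (Q F sigma tau : set 'cV[R]_2) (v w : 'cV[int]_2).

Definition latt v : 'cV[R]_2 := map_mx intr v.

Definition conv (s : seq 'cV[int]_2) : set 'cV[R]_2 :=
  smallest (@convex_set R 'cV[R]_2) (latt @` [set` s]).

(* The nonempty proper faces of a two-dimensional polygon: its intersections
   with supporting lines [u x = c]; [u != 0] excludes Q itself. *)
Definition proper_face Q F : Prop :=
  F !=set0 /\
  exists (u : 'rV[R]_2) (c : R),
    [/\ u != 0,
        forall x, Q x -> (u *m x) ord0 ord0 <= c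
      & F = [set x | Q x /\ (u *m x) ord0 ord0 = c]].

Definition vertices Q : set 'cV[R]_2 := [set x | proper_face Q [set x]].

Definition edge Q F : Prop :=
  proper_face Q F /\ exists x y, [/\ F x, F y & x != y].

Definition lattice_polygon Q : Prop := exists s, Q = conv s.

Definition LDP_polygon Q : Prop :=
  [/\ lattice_polygon Q, interior Q 0
    & forall x, vertices Q x -> exists2 v, x = latt v & primitive v].

Definition lin_image (M : 'M[int]_2) (A : set 'cV[R]_2) : set 'cV[R]_2 :=
  (fun x => map_mx intr M *m x) @` A.

Definition unimodular (M : 'M[int]_2) : Prop := \det M = 1 \/ \det M = -1.

Definition equivalent Q Q' : Prop :=
  exists2 M, unimodular M & lin_image M Q = Q'.

Definition cone_over F : set 'cV[R]_2 :=
  [set x | exists (l : R) y, [/\ 0 <= l, F y & x = l *: y]].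

Definition cone_face sigma tau : Prop :=
  exists u : 'rV[R]_2,
    (forall x, sigma x -> 0 <= (u *m x) ord0 ord0) /\
    tau = [set x | sigma x /\ (u *m x) ord0 ord0 = 0].

Definition fan_of Q : set (set 'cV[R]_2) :=
  [set tau | exists2 F, edge Q F & cone_face (cone_over F) tau].

Definition toric_isom (D D' : set (set 'cV[R]_2)) : Prop :=
  exists2 M, unimodular M & lin_image M @` D = D'.

(* The pair (v, w) is (v_i, v_{i+1}) for the counterclockwise ordering of the
   vertices (the origin being interior); it labels the torus-fixed point of
   the cone spanned by v and w. *)
Definition fixed_points Q : set ('cV[int]_2 * 'cV[int]_2) :=
  [set p | edge Q (conv [:: p.1; p.2]) /\ 0 < det2 p.1 p.2].

Definition singular_points Q : set ('cV[int]_2 * 'cV[int]_2) :=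
  [set p | fixed_points Q p /\ 2 <= det2 p.1 p.2].

(* Lattice polygons have finitely many vertices and edges, so [fset_set] is
   not applied to an infinite set. *)
Definition nb_singular_points Q : nat := #|` fset_set (singular_points Q)|.

Definition picard_number Q : nat := (#|` fset_set (vertices Q)| - 2)%N.

Definition blowup_fan (D : set (set 'cV[R]_2)) v w : set (set 'cV[R]_2) :=
  (D `\ cone_over (conv [:: v; w])) `|`
  [set cone_over (conv [:: v; v + w]);
       cone_over (conv [:: v + w; w]);
       cone_over (conv [:: v + w])].

End Plane.

(* Main.v *)
Require Import Defs.
From mathcomp Require Import zify ring lra.

(* An edge (v, w) is smooth when det(v, w) = 1; then the functional
   f(u) = det(u, w) + det(v, u), which is 1 on the edge, takes values at most 0 at
   every other vertex. In the lattice basis (v, w) two such functionals conflict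
   unless their edges are close to each other: a polygon with at least five
   vertices has no isolated smooth edge besides other smooth edges, and when a run
   of smooth edges starts after a singular one, all smooth edges lie among its
   first three. Three singular edges thus allow at most six vertices. For five
   vertices the two smooth edges are adjacent, and their basis gives the normal
   form (2). For six vertices the three smooth edges are consecutive, and one of
   their two common vertices is the sum of its neighbours, so it can be removed.
   Conversely the number of singular points is read off the fan, since a
   two-dimensional cone determines its primitive generators, and blowing up a
   smooth cone only exchanges cones of determinant 1.
   Convex geometry enters through one device: the point x lies in the cone of the
   edge whose normalised functional is maximal at x. *)

Set Implicit Arguments.
Unset Strict Implicit.
Unset Printing Implicit Defensive.

Implicit Types (u v w : 'cV[int]_2) (M : 'M[int]_2).

Local Notation X u := (u ord0 ord0).
Local Notation Y u := (u ord_max ord0).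

(** * Lattice vectors and convex sets *)

(** The functional of a smooth edge is integral and less than 1 off the edge, hence at most 0 there.
    Value 0 leaves a primitive vector only the coordinates (1, -1) or (-1, 1), so the value is
    negative as soon as one coordinate has absolute value at least 2; a singular edge next to the
    smooth one provides exactly such a coordinate. This gain of one unit drives the conflict between
    two smooth edges. Five vertices are required because the conflict argument leaves one exception,
    in which the two edges are opposite sides of a quadrilateral. The other obstacle is that [Q] is
    a bare convex set and a fan a bare set of cones. The cyclic order is therefore rebuilt as two
    maps [n] and [p], whose record does not assert that they run through all vertices in one cycle:
    this follows from convexity. Singular points are recounted as pairs of primitive vectors
    spanning a cone of the fan, which makes sense without any polygon, in particular for the fan of
    a blow-up. *)

Lemma col2P (T : Type) (x y : 'cV[T]_2) : X x = X y -> Y x = Y y -> x = y.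
Proof.
move=> hX hY; apply/matrixP => i j; rewrite ord1 {j}.
case: i => -[|[|//]] i2; first by have -> : Ordinal i2 = ord0 by apply: val_inj.
by have -> : Ordinal i2 = ord_max by apply: val_inj.
Qed.

Lemma mul_row_col2 (T : pzSemiRingType) m (A : 'M[T]_(m, 2)) (x : 'cV[T]_2) i :
  (A *m x) i ord0 = A i ord0 * X x + A i ord_max * Y x.
Proof.
rewrite mxE big_ord_recl big_ord1.
by have -> : lift ord0 ord0 = ord_max :> 'I_2 by apply: val_inj.
Qed.

Lemma vec2X x y : X (vec2 x y) = x. Proof. by rewrite mxE. Qed.
Lemma vec2Y x y : Y (vec2 x y) = y. Proof. by rewrite mxE. Qed.
Definition vec2E := (vec2X, vec2Y).

Lemma det2C v w : det2 v w = - det2 w v.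
Proof. by rewrite /det2; ring. Qed.

Lemma det2vv v : det2 v v = 0.
Proof. by rewrite /det2; ring. Qed.

Lemma det2_cramer v w u : det2 v w *: u = det2 u w *: v + det2 v u *: w.
Proof. by apply: col2P; rewrite /det2 !mxE; ring. Qed.

Lemma det2_inj v w u1 u2 : det2 v w != 0 ->
  det2 v u1 = det2 v u2 -> det2 u1 w = det2 u2 w -> u1 = u2.
Proof.
move=> d0 h1 h2; have e : det2 v w *: u1 = det2 v w *: u2.
  by rewrite (det2_cramer v w u1) h1 h2 -det2_cramer.
by apply: col2P; apply: (mulfI d0);
  [have := congr1 (fun z : 'cV[int]_2 => X z) e | have := congr1 (fun z : 'cV[int]_2 => Y z) e]; rewrite !mxE.
Qed.

Lemma det_mx2 (T : comPzRingType) (M : 'M[T]_2) :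
  \det M = M ord0 ord0 * M ord_max ord_max - M ord_max ord0 * M ord0 ord_max.
Proof.
rewrite (expand_det_row _ ord0) big_ord_recl big_ord1 /cofactor !det_mx11 !mxE /=.
have -> : lift ord0 ord0 = ord_max :> 'I_2 by apply: val_inj.
have -> : lift ord_max ord0 = ord0 :> 'I_2 by apply: val_inj.
by rewrite expr0 expr1; ring.
Qed.

Lemma det2_mul M v w : det2 (M *m v) (M *m w) = \det M * det2 v w.
Proof. by rewrite /det2 !mul_row_col2 det_mx2; ring. Qed.

Lemma primitiveP v : primitive v <-> exists w, det2 v w = 1.
Proof.
rewrite /primitive; split => [h|[w h]].
  have /eqP/coprimezP[[a b] /= e] := h.
  by exists (vec2 (- b) a); rewrite /det2 !vec2E; lia.
apply/eqP; rewrite -[_ == _]/(coprimez _ _); apply/coprimezP.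
by exists (Y w, - X w) => /=; rewrite /det2 in h; lia.
Qed.

(** A complement of [v] yields w = c v with an integer c; a complement of [w] makes c a unit. *)
Lemma primitive_coprime_line v w : primitive v -> primitive w ->
  det2 v w = 0 -> w = v \/ w = - v.
Proof.
move=> /primitiveP[v' hv'] /primitiveP[w' hw'] h.
pose c := det2 w v'.
have ew : w = c *: v.
  apply: (@det2_inj v v'); rewrite ?hv' //.
    by rewrite h /det2 !mxE; ring.
  have -> : det2 (c *: v) v' = c * det2 v v' by rewrite /det2 !mxE; ring.
  by rewrite hv' mulr1.
have : c * det2 v w' = 1 by rewrite -hw' ew /det2 !mxE; ring.
move: (det2 v w') => d cd.
have [c1|c1] : c = 1 \/ c = -1 by
  have : (c %| 1)%Z by [apply/dvdzP; exists d; rewrite mulrC]; rewrite dvdz1; lia.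
  by left; rewrite ew c1 scale1r.
by right; rewrite ew c1 scaleN1r.
Qed.

Section Plane.
Variable R : realType.
Implicit Types (x y : 'cV[R]_2).

Definition rdet x y : R := X x * Y y - Y x * X y.

Lemma lattX u : X (latt R u) = (X u)%:~R. Proof. by rewrite mxE. Qed.
Lemma lattY u : Y (latt R u) = (Y u)%:~R. Proof. by rewrite mxE. Qed.
Definition lattE := (lattX, lattY).

Lemma latt_inj : injective (latt R).
Proof.
move=> u v /matrixP e; apply: col2P; apply/eqP; rewrite -(eqr_int R).
  by have := e ord0 ord0; rewrite !lattE => ->.
by have := e ord_max ord0; rewrite !lattE => ->.
Qed.

Lemma rdet_latt u v : rdet (latt R u) (latt R v) = (det2 u v)%:~R.
Proof. by rewrite /rdet !lattE /det2 intrB !intrM. Qed.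

(* The affine line through [v] and [w] is [edgef v w = det2 v w]. *)
Definition edgef v w x : R := rdet x (latt R w) + rdet (latt R v) x.

Lemma edgef_latt v w u : edgef v w (latt R u) = (det2 u w + det2 v u)%:~R.
Proof. by rewrite /edgef !rdet_latt intrD. Qed.

Lemma edgefD v w x y : edgef v w (x + y) = edgef v w x + edgef v w y.
Proof. by rewrite /edgef /rdet !mxE; ring. Qed.

Lemma edgefZ v w a x : edgef v w (a *: x) = a * edgef v w x.
Proof. by rewrite /edgef /rdet !mxE; ring. Qed.

Lemma edgef_l v w : edgef v w (latt R v) = (det2 v w)%:~R.
Proof. by rewrite edgef_latt det2vv addr0. Qed.

Lemma edgef_r v w : edgef v w (latt R w) = (det2 v w)%:~R.
Proof. by rewrite edgef_latt det2vv add0r. Qed.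

Lemma edgef_comb v w a b :
  edgef v w (a *: latt R v + b *: latt R w) = (a + b) * (det2 v w)%:~R.
Proof. by rewrite edgefD !edgefZ edgef_l edgef_r mulrDl. Qed.

Lemma convexP (A : set 'cV[R]_2) : @convex_set R 'cV[R]_2 A <->
  forall x y a b, A x -> A y -> 0 <= a -> 0 <= b -> a + b = 1 -> A (a *: x + b *: y).
Proof.
split=> [h x y a b Ax Ay a0 b0 ab|h x y l /set_mem Ax /set_mem Ay].
  have a1 : a <= 1 by lra.
  have := h x y (Itv01 a0 a1) (mem_set Ax) (mem_set Ay).
  move/set_mem; rewrite /convex.conv /= /unstable.onem.
  by have -> : 1 - a = b by lra.
apply/mem_set; rewrite /convex.conv /= /unstable.onem; apply: h => //.
by rewrite addrC subrK.
Qed.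

Lemma convex3 (A : set 'cV[R]_2) x y z a b c : @convex_set R 'cV[R]_2 A ->
  A x -> A y -> A z -> 0 <= a -> 0 <= b -> 0 <= c -> a + b + c = 1 ->
  A (a *: x + b *: y + c *: z).
Proof.
move=> /convexP cA Ax Ay Az a0 b0 c0 abc.
have [ab|ab] := eqVneq (a + b) 0.
  have [a00 b00 c1] : [/\ a = 0, b = 0 & c = 1] by split; lra.
  by rewrite a00 b00 c1 !scale0r scale1r !add0r.
have -> : a *: x + b *: y = (a + b) *: ((a / (a + b)) *: x + (b / (a + b)) *: y).
  by rewrite scalerDr !scalerA !(mulrC (a + b)) !divfK.
apply: (cA); rewrite ?addr_ge0 //.
by apply: cA; rewrite ?divr_ge0 ?addr_ge0 // -mulrDl divff.
Qed.

Lemma convex_conv s : @convex_set R 'cV[R]_2 (@conv R s).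
Proof.
apply/convexP => x y a b cx cy a0 b0 ab A hA; have [/convexP cA _] := hA.
by apply: cA => //; [exact: cx | exact: cy].
Qed.

Lemma mem_conv s u : u \in s -> @conv R s (latt R u).
Proof. by move=> us A [_ sA]; apply: sA; exists u. Qed.

Lemma conv_sub s (A : set 'cV[R]_2) : @convex_set R 'cV[R]_2 A ->
  (forall u, u \in s -> A (latt R u)) -> @conv R s `<=` A.
Proof. by move=> cA sA; apply: smallest_sub => // _ [u us <-]; apply: sA. Qed.

Lemma sub_conv s t : {subset s <= t} -> @conv R s `<=` @conv R t.
Proof.
by move=> st; apply: conv_sub (@convex_conv t) _ => u /st; exact: mem_conv.
Qed.

Lemma conv2P v w x : @conv R [:: v; w] x <->
  exists a b, [/\ 0 <= a, 0 <= b, a + b = 1 & x = a *: latt R v + b *: latt R w].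
Proof.
split=> [|[a [b [a0 b0 ab ->]]]]; last first.
  move: (@convex_conv [:: v; w]) => /convexP; apply=> //.
    by apply: mem_conv; rewrite inE eqxx.
  by apply: mem_conv; rewrite !inE eqxx orbT.
move: x; apply: conv_sub.
  apply/convexP => x y a b [c [d [c0 d0 cd ->]]] [e [f [e0 f0 ef ->]]] a0 b0 ab.
  exists (a * c + b * e), (a * d + b * f); split; rewrite ?addr_ge0 ?mulr_ge0 //.
    nra.
  by rewrite !scalerDr !scalerDl !scalerA addrACA.
move=> u; rewrite !inE => /orP[]/eqP->.
  by exists 1, 0; rewrite scale1r scale0r !addr0.
by exists 0, 1; rewrite scale1r scale0r !add0r.
Qed.

Lemma convex_le (g : 'cV[R]_2 -> R) c :
  (forall x y, g (x + y) = g x + g y) -> (forall a x, g (a *: x) = a * g x) ->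
  @convex_set R 'cV[R]_2 [set x | g x <= c].
Proof.
move=> gD gZ; apply/convexP => x y a b /= gx gy a0 b0 ab.
rewrite gD !gZ; have -> : c = a * c + b * c by rewrite -mulrDl ab mul1r.
by rewrite lerD // ler_wpM2l.
Qed.

End Plane.

(** * Cyclically ordered polygons *)

Lemma seq_argmax (R : realDomainType) (T : eqType) (g : T -> R) (s : seq T) :
  s != [::] -> exists2 x, x \in s & forall y, y \in s -> g y <= g x.
Proof.
elim: s => // a [|b s] IH _.
  by exists a; [rewrite inE|move=> y; rewrite inE => /eqP->].
have [//|x xs hx] := IH.
have [le|/ltW le] := leP (g a) (g x).
  by exists x; [rewrite inE xs orbT|move=> y; rewrite inE => /orP[/eqP->//|/hx]].
exists a; first by rewrite inE eqxx.
by move=> y; rewrite inE => /orP[/eqP->//|/hx h]; apply: le_trans h le.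
Qed.

(* [n] and [p] send a vertex to its counterclockwise successor and predecessor. *)
Record ngon (V : seq 'cV[int]_2) (n p : 'cV[int]_2 -> 'cV[int]_2) : Prop := Ngon {
  ngon_uniq : uniq V;
  ngon_neq0 : V != [::];
  ngon_next : {in V, forall v, n v \in V};
  ngon_prev : {in V, forall v, p v \in V};
  ngon_nextK : {in V, cancel n p};
  ngon_prevK : {in V, cancel p n};
  ngon_det : {in V, forall v, 0 < det2 v (n v)};
  ngon_supp : {in V &, forall v u, u != v -> u != n v ->
    det2 u (n v) + det2 v u < det2 v (n v)} }.

Section Ngon.
Variables (R : realType) (V : seq 'cV[int]_2) (n p : 'cV[int]_2 -> 'cV[int]_2).
Hypothesis VP : ngon V n p.
Let Vn := ngon_next VP.
Let Vp := ngon_prev VP.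
Let nK := ngon_nextK VP.
Let pK := ngon_prevK VP.
Let Vdet := ngon_det VP.
Let Vsupp := ngon_supp VP.
Local Notation latt := (latt R).
Local Notation edgef := (@edgef R).

Lemma ngon_detp v : v \in V -> 0 < det2 (p v) v.
Proof. by move=> vV; have := Vdet (Vp vV); rewrite pK. Qed.

Lemma next_neq v : v \in V -> n v != v.
Proof. by move=> /Vdet; apply: contraTneq => ->; rewrite det2vv. Qed.

Lemma prev_neq v : v \in V -> p v != v.
Proof. by move=> /ngon_detp; apply: contraTneq => ->; rewrite det2vv. Qed.

Lemma next_neq_prev v : v \in V -> n v != p v.
Proof.
move=> vV; have := ngon_detp vV; apply: contraTneq => <-.
by have := Vdet vV; rewrite det2C; lia.
Qed.

Lemma next_inj v w : v \in V -> w \in V -> n v = n w -> v = w.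
Proof. by move=> vV wV e; rewrite -(nK vV) e nK. Qed.

Lemma next2_neq v : v \in V -> n (n v) != v.
Proof.
move=> vV; apply: contraNneq (next_neq_prev (Vn vV)) => ->.
by rewrite nK.
Qed.

Lemma ngon_supp_le v u : v \in V -> u \in V ->
  det2 u (n v) + det2 v u <= det2 v (n v).
Proof.
move=> vV uV; have [->|uv] := eqVneq u v; first by rewrite det2vv addr0.
have [->|un] := eqVneq u (n v); first by rewrite det2vv add0r.
exact/ltW/Vsupp.
Qed.

Lemma ngon_supp_leR v u : v \in V -> u \in V ->
  edgef v (n v) (latt u) <= (det2 v (n v))%:~R.
Proof. by move=> vV uV; rewrite edgef_latt ler_int; exact: ngon_supp_le. Qed.

Lemma edgef_eqR v u : v \in V -> u \in V ->
  edgef v (n v) (latt u) = (det2 v (n v))%:~R -> u = v \/ u = n v.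
Proof.
move=> vV uV; rewrite edgef_latt => /eqP; rewrite eqr_int => /eqP e.
have [->|uv] := eqVneq u v; first by left.
have [->|un] := eqVneq u (n v); first by right.
by have := Vsupp vV uV uv un; rewrite e ltxx.
Qed.

Lemma rdet_cramer v w (x : 'cV[R]_2) : 0 < det2 v w ->
  x = (rdet x (latt w) / (det2 v w)%:~R) *: latt v
      + (rdet (latt v) x / (det2 v w)%:~R) *: latt w.
Proof.
rewrite -(ltr0z R) => /lt0r_neq0; rewrite -rdet_latt /rdet !lattE => d.
by apply: col2P; rewrite !mxE; field.
Qed.

(* A maximiser [v] of the normalised edge functionals at [x] has [x] in its
   cone: a negative coordinate of [x] on [v] (resp. [n v]) would make the
   functional of [n v] (resp. [p v]) larger. *)
Lemma ngon_cover (W : seq 'cV[int]_2) (x : 'cV[R]_2) :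
  W != [::] -> {subset W <= V} ->
  {in W, forall v, n v \in W} -> {in W, forall v, p v \in W} ->
  exists v a b, [/\ v \in W, 0 <= a, 0 <= b & x = a *: latt v + b *: latt (n v)].
Proof.
move=> W0 WV Wn Wp.
have [v vW vmax] := seq_argmax (fun v => edgef v (n v) x / (det2 v (n v))%:~R) W0.
have D0 w : w \in W -> 0 < (det2 w (n w))%:~R :> R.
  by move=> wW; rewrite ltr0z Vdet // WV.
have vV := WV _ vW.
set a := rdet x (latt (n v)) / (det2 v (n v))%:~R.
set b := rdet (latt v) x / (det2 v (n v))%:~R.
have xE : x = a *: latt v + b *: latt (n v) by exact/rdet_cramer/Vdet.
have gv : edgef v (n v) x / (det2 v (n v))%:~R = a + b by rewrite /edgef mulrDl.
exists v, a, b; split=> //.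
  rewrite leNgt; apply/negP => a0.
  have := vmax _ (Wn _ vW); apply/negP; rewrite -ltNge gv.
  have d0 := D0 _ (Wn _ vW); rewrite ltr_pdivlMr //.
  rewrite [in ltRHS]xE edgefD !edgefZ edgef_l.
  rewrite mulrDl ltrD2r ltr_nM2l // edgef_latt ltr_int.
  by rewrite Vsupp ?Vn // eq_sym ?next_neq ?next2_neq.
rewrite leNgt; apply/negP => b0.
have := vmax _ (Wp _ vW); apply/negP; rewrite -ltNge gv.
have d0 := D0 _ (Wp _ vW); rewrite ltr_pdivlMr //.
rewrite [in ltRHS]xE edgefD !edgefZ pK //.
rewrite -[Z in edgef _ Z (latt v)](pK vV) -[Z in edgef _ _ (latt Z)](pK vV).
rewrite edgef_r pK //.
rewrite mulrDl ltrD2l ltr_nM2l // edgef_latt ltr_int.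
by have := Vsupp (Vp vV) (Vn vV); rewrite pK //; apply; rewrite ?next_neq ?next_neq_prev.
Qed.

Lemma ngon_coverV x : exists v a b,
  [/\ v \in V, 0 <= a, 0 <= b & x = a *: latt v + b *: latt (n v)].
Proof. exact: ngon_cover (ngon_neq0 VP) _ Vn Vp. Qed.

Lemma sum_le1 v a b : v \in V ->
  edgef v (n v) (a *: latt v + b *: latt (n v)) <= (det2 v (n v))%:~R -> a + b <= 1.
Proof.
move=> vV; rewrite edgef_comb -{2}[(_%:~R)]mul1r ler_pM2r //.
by rewrite ltr0z Vdet.
Qed.

Lemma conv_ngon0 : conv V (0 : 'cV[R]_2).
Proof.
have [v vV] : exists v, v \in V.
  by case: V (ngon_neq0 VP) => // v W _; exists v; rewrite inE eqxx.
(* As -v lies in the cone of some edge, v + a w + b (n w) = 0; dividing by the total weight gives a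
   convex combination. *)
have [w [a [b [wV a0 b0 e]]]] := ngon_coverV (- latt v).
have c0 : 0 < 1 + a + b by lra.
have -> : 0 = (1 / (1 + a + b)) *: latt v + (a / (1 + a + b)) *: latt w
              + (b / (1 + a + b)) *: latt (n w).
  rewrite ![_ / (1 + a + b)]mulrC -!scalerA -!scalerDr scale1r -[latt v + _ + _]addrA -e.
  by rewrite subrr scaler0.
apply: convex3; rewrite ?divr_ge0 ?(ltW c0) //; first exact: convex_conv.
- exact: mem_conv.
- exact: mem_conv.
- by apply: mem_conv; apply: Vn.
- by rewrite -!mulrDl divff // gt_eqF.
Qed.

Lemma conv_ngonP x :
  conv V x <-> {in V, forall v, edgef v (n v) x <= (det2 v (n v))%:~R}.
Proof.
split.
  move=> cx v vV; move: x cx.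
  apply: (@conv_sub R V [set x | edgef v (n v) x <= (det2 v (n v))%:~R]).
    by apply: convex_le; [exact: edgefD|exact: edgefZ].
  by move=> u uV; exact: ngon_supp_leR.
move=> h; have [v [a [b [vV a0 b0 e]]]] := ngon_coverV x.
have ab : a + b <= 1 by apply: (@sum_le1 v) => //; rewrite -e; exact: h.
(* Here [x] is a convex combination of 0, [v] and [n v], with weight 1 - a - b on 0. *)
rewrite e -[Z in Z + _]add0r -(scaler0 _ (1 - a - b)).
apply: convex3; rewrite //; [exact: convex_conv|exact: conv_ngon0|exact: mem_conv| | |].
- by apply: mem_conv; apply: Vn.
- lra.
- lra.
Qed.

(* [V] is a single orbit: the cones of a closed subset [W] already cover the
   plane, and a vertex outside [W] would be cut off by their edges. *)
Lemma ngon_orbit (W : seq 'cV[int]_2) : W != [::] -> {subset W <= V} ->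
  {in W, forall v, n v \in W} -> {in W, forall v, p v \in W} -> {subset V <= W}.
Proof.
move=> W0 WV Wn Wp u uV; apply/negPn/negP => uW.
have [v [a [b [vW a0 b0 e]]]] := ngon_cover (latt u) W0 WV Wn Wp.
have vV := WV _ vW.
have ab : a + b < 1.
  have := edgef_comb v (n v) a b; rewrite -e edgef_latt => h.
  rewrite -(@ltr_pM2r _ (det2 v (n v))%:~R) ?ltr0z ?Vdet // -h mul1r ltr_int.
  by rewrite Vsupp //; apply: contraNneq uW => -> //; exact: Wn.
(* At [u] itself the functional of the edge at [u] attains its bound; estimated through [v] and
   [n v] it reaches only a + b < 1 times that bound. *)
have := edgef_l R u (n u); rewrite e edgefD !edgefZ => h.
have h1 := ngon_supp_leR uV vV; have h2 := ngon_supp_leR uV (Vn vV).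
have d0 : 0 < (det2 u (n u))%:~R :> R by rewrite ltr0z Vdet.
move: h h1 h2 d0; move: (edgef _ _ _) (edgef _ _ _) (_%:~R) => f g d h h1 h2 d0.
nra.
Qed.

End Ngon.

(** * Planar cones *)

Section Cones.
Variable R : realType.
Implicit Types (x y z : 'cV[R]_2) (l : 'rV[R]_2).
Local Notation latt := (latt R).

Definition row2 (a b : R) : 'rV[R]_2 := \row_j [:: a; b]`_j.

Lemma row2E a b x : (row2 a b *m x) ord0 ord0 = a * X x + b * Y x.
Proof. by rewrite mul_row_col2 !mxE. Qed.

Lemma rowD l x y : (l *m (x + y)) ord0 ord0 = (l *m x) ord0 ord0 + (l *m y) ord0 ord0.
Proof. by rewrite mulmxDr mxE. Qed.

Lemma rowZ l a x : (l *m (a *: x)) ord0 ord0 = a * (l *m x) ord0 ord0.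
Proof. by rewrite -scalemxAr mxE. Qed.

Definition row_comb := (rowD, rowZ).

Lemma rdet_combl a b x y z : rdet (a *: x + b *: y) z = a * rdet x z + b * rdet y z.
Proof. by rewrite /rdet !mxE; ring. Qed.

Lemma rdet_combr a b x y z : rdet z (a *: x + b *: y) = a * rdet z x + b * rdet z y.
Proof. by rewrite /rdet !mxE; ring. Qed.

Lemma rdetvv x : rdet x x = 0.
Proof. by rewrite /rdet; ring. Qed.

Lemma latt_comb_inj v w (a b c d : R) : det2 v w != 0 ->
  a *: latt v + b *: latt w = c *: latt v + d *: latt w -> a = c /\ b = d.
Proof.
rewrite -(intr_eq0 R) -rdet_latt => d0 e.
have eX := congr1 (fun z => rdet z (latt w)) e.
have eY := congr1 (fun z => rdet (latt v) z) e.
move: eX eY; rewrite /= !rdet_combl !rdet_combr !rdetvv !mulr0 !addr0 !add0r.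
by move=> /(mulIf d0) -> /(mulIf d0) ->.
Qed.

Lemma cone2P v w x : cone_over (conv [:: v; w]) x <->
  exists a b : R, [/\ 0 <= a, 0 <= b & x = a *: latt v + b *: latt w].
Proof.
split=> [[l [y [l0 /conv2P[a [b [a0 b0 _ ->]]] ->]]]|[a [b [a0 b0 ->]]]].
  by exists (l * a), (l * b); rewrite !mulr_ge0 // scalerDr !scalerA.
have [ab|ab] := eqVneq (a + b) 0.
  have [-> ->] : a = 0 /\ b = 0 by split; lra.
  exists 0, (latt v); rewrite !scale0r addr0; split=> //.
  by apply: mem_conv; rewrite inE eqxx.
exists (a + b), ((a / (a + b)) *: latt v + (b / (a + b)) *: latt w).
split; first exact: addr_ge0.
  apply/conv2P; exists (a / (a + b)), (b / (a + b)).
  by rewrite !divr_ge0 ?addr_ge0 // -mulrDl divff.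
by rewrite scalerDr !scalerA !(mulrC (a + b)) !divfK.
Qed.

Lemma conv1P v x : conv [:: v] x <-> x = latt v.
Proof.
split=> [|->]; last by apply: mem_conv; rewrite inE.
move: x; apply: (@conv_sub R [:: v] [set x | x = latt v]).
  by apply/convexP => x y a b /= -> -> _ _ ab; rewrite -scalerDl ab scale1r.
by move=> u; rewrite inE => /eqP ->.
Qed.

Lemma cone1P v x : cone_over (conv [:: v]) x <->
  exists a : R, 0 <= a /\ x = a *: latt v.
Proof.
split=> [[l [y [l0 /conv1P-> ->]]]|[a [a0 ->]]]; first by exists l.
by exists a, (latt v); split=> //; apply/conv1P.
Qed.

Lemma cone2l v w : cone_over (conv [:: v; w]) (latt v).
Proof. by apply/cone2P; exists 1, 0; rewrite scale1r scale0r addr0. Qed.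

Lemma cone2r v w : cone_over (conv [:: v; w]) (latt w).
Proof. by apply/cone2P; exists 0, 1; rewrite scale1r scale0r add0r. Qed.

(** A generator spans an extremal ray: if [v'] had positive coefficients on both [v] and [w], then
    expanding these two in [v'] and [w'] would put both of them on the ray of [v']. *)
Lemma cone2_ray v w v' w' : det2 v w != 0 -> det2 v' w' != 0 ->
  cone_over (@conv R [:: v; w]) = cone_over (conv [:: v'; w']) ->
  (exists2 a : R, 0 < a & latt v' = a *: latt v) \/
  (exists2 a : R, 0 < a & latt v' = a *: latt w).
Proof.
move=> d d' E.
have /cone2P[s [t [s0 t0 ev]]] : cone_over (conv [:: v'; w']) (latt v).
  by rewrite -E; exact: cone2l.
have /cone2P[s' [t' [s0' t0' ew]]] : cone_over (conv [:: v'; w']) (latt w).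
  by rewrite -E; exact: cone2r.
have /cone2P[e [f [e0 f0 ev']]] : cone_over (conv [:: v; w]) (latt v').
  by rewrite E; exact: cone2l.
have [s1 t1] : e * s + f * s' = 1 /\ e * t + f * t' = 0.
  apply: (@latt_comb_inj v' w') => //.
  by rewrite scale1r scale0r addr0 [RHS]ev' ev ew !scalerDr !scalerA !scalerDl addrACA.
have [e1|e1] := eqVneq e 0.
  right; exists f; last by rewrite ev' e1 scale0r add0r.
  by rewrite lt_neqAle eq_sym f0 andbT; apply/eqP => f1; move: s1; rewrite e1 f1 !mul0r addr0 => /eqP; rewrite eq_sym oner_eq0.
have [f1|f1] := eqVneq f 0.
  by left; exists e; [rewrite lt_neqAle eq_sym e1|rewrite ev' f1 scale0r addr0].
have et0 : e * t = 0 by have := mulr_ge0 e0 t0; have := mulr_ge0 f0 t0'; lra.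
have ft0 : f * t' = 0 by have := mulr_ge0 e0 t0; have := mulr_ge0 f0 t0'; lra.
move/eqP: et0; rewrite mulf_eq0 (negPf e1) => /eqP t00.
move/eqP: ft0; rewrite mulf_eq0 (negPf f1) => /eqP t00'.
have : rdet (latt v) (latt w) = 0.
  by rewrite ev ew t00 t00' /rdet !mxE; ring.
by rewrite rdet_latt => /eqP; rewrite intr_eq0 (negPf d).
Qed.

(** Orientation selects the matching of rays: exchanging them would make [det2 v' w'] negative, and
    two generators on one ray would make it zero. *)
Lemma cone2_rays v w v' w' : 0 < det2 v w -> 0 < det2 v' w' ->
  cone_over (@conv R [:: v; w]) = cone_over (conv [:: v'; w']) ->
  (exists2 a : R, 0 < a & latt v' = a *: latt v) /\
  (exists2 a : R, 0 < a & latt w' = a *: latt w).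
Proof.
move=> d d' E.
have convC u u' : @conv R [:: u; u'] = conv [:: u'; u].
  by apply/seteqP; split; apply: sub_conv => z; rewrite !inE orbC.
have dd : 0 < rdet (latt v') (latt w') by rewrite rdet_latt ltr0z.
have d1 : 0 < rdet (latt v) (latt w) by rewrite rdet_latt ltr0z.
have Hw : (exists2 a : R, 0 < a & latt w' = a *: latt v) \/
          (exists2 a : R, 0 < a & latt w' = a *: latt w).
  have d2 : det2 w' v' != 0 by rewrite det2C oppr_eq0 gt_eqF.
  by apply: (cone2_ray (lt0r_neq0 d) d2); rewrite E convC.
have [[a a0 ea]|[a a0 ea]] := cone2_ray (lt0r_neq0 d) (lt0r_neq0 d') E;
  have [[b b0 eb]|[b b0 eb]] := Hw.
- by exfalso; move: dd; rewrite ea eb /rdet !mxE; nra.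
- by split; [exists a|exists b].
- exfalso; move: dd; rewrite ea eb => dd.
  have : rdet (a *: latt w) (b *: latt v) = - (a * b * rdet (latt v) (latt w)).
    by rewrite /rdet !mxE; ring.
  by have := mulr_gt0 (mulr_gt0 a0 b0) d1; lra.
- by exfalso; move: dd; rewrite ea eb /rdet !mxE; nra.
Qed.

Lemma latt_pos_inj v w (a : R) : primitive v -> primitive w -> 0 < a ->
  latt w = a *: latt v -> w = v.
Proof.
move=> vP wP a0 e.
have d0 : det2 v w = 0.
  apply/eqP; rewrite -(intr_eq0 R) -rdet_latt e; apply/eqP.
  by rewrite /rdet !mxE; ring.
have [//|ewv] := primitive_coprime_line vP wP d0.
have v0 : latt v = 0.
  have : (1 + a) *: latt v = 0.
    rewrite scalerDl scale1r -e ewv; apply: col2P; rewrite !mxE; ring.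
  by move/eqP; rewrite scaler_eq0 gt_eqF ?addr_gt0 //= => /eqP.
by rewrite ewv; apply: (@latt_inj R); apply/eqP; rewrite -subr_eq0; apply/eqP;
  apply: col2P; move: v0 => /matrixP v0; have := v0 ord0 ord0; have := v0 ord_max ord0; rewrite !mxE; lra.
Qed.

Lemma cone2_inj v w v' w' : primitive v -> primitive w -> primitive v' -> primitive w' ->
  0 < det2 v w -> 0 < det2 v' w' ->
  cone_over (@conv R [:: v; w]) = cone_over (conv [:: v'; w']) -> v' = v /\ w' = w.
Proof.
move=> vP wP vP' wP' d d' /cone2_rays-/(_ d d')[[a a0 ea] [b b0 eb]].
by split; [apply: latt_pos_inj ea|apply: latt_pos_inj eb].
Qed.

(** The segment meets each bounding ray of its cone in a single point, so the scale left open by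
    [cone2_rays] is 1. *)
Lemma conv2_inj v w v' w' : 0 < det2 v w -> 0 < det2 v' w' ->
  @conv R [:: v; w] = conv [:: v'; w'] -> v' = v /\ w' = w.
Proof.
move=> d d' E; have := congr1 (@cone_over R) E.
move=> /cone2_rays-/(_ d d')[[a a0 ea] [b b0 eb]].
have /conv2P[s [t [s0 t0 st ev]]] : conv [:: v; w] (latt v').
  by rewrite E; apply: mem_conv; rewrite inE eqxx.
have /conv2P[s' [t' [s0' t0' st' ew]]] : conv [:: v; w] (latt w').
  by rewrite E; apply: mem_conv; rewrite !inE eqxx orbT.
have d0 := lt0r_neq0 d.
have [sa ta] : a = s /\ 0 = t.
  by apply: (latt_comb_inj d0); rewrite -ev ea scale0r addr0.
have [sb tb] : 0 = s' /\ b = t'.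
  by apply: (latt_comb_inj d0); rewrite -ew eb scale0r add0r.
have a1 : a = 1 by lra.
have b1 : b = 1 by lra.
by split; apply: (@latt_inj R); rewrite ?ea ?eb ?a1 ?b1 scale1r.
Qed.

Lemma cone2_neq_flat v w (A : set 'cV[R]_2) : 0 < det2 v w ->
  (forall x y, A x -> A y -> rdet x y = 0) -> cone_over (conv [:: v; w]) <> A.
Proof.
move=> d h E; have := h (latt v) (latt w); rewrite -E rdet_latt.
move=> /(_ (@cone2l v w) (@cone2r v w)) /eqP; rewrite intr_eq0.
by rewrite gt_eqF.
Qed.

Lemma cone1_flat v x y : cone_over (conv [:: v]) x -> cone_over (conv [:: v]) y ->
  rdet x y = 0.
Proof.
by move=> /cone1P[a [_ ->]] /cone1P[b [_ ->]]; rewrite /rdet !mxE; ring.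
Qed.

Lemma cone_face2P v w (tau : set 'cV[R]_2) : 0 < det2 v w ->
  cone_face (cone_over (conv [:: v; w])) tau <->
  [\/ tau = cone_over (conv [:: v; w]), tau = cone_over (conv [:: v]),
      tau = cone_over (conv [:: w]) | tau = [set 0]].
Proof.
move=> d; have d0 := lt0r_neq0 d; have dR : 0 < rdet (latt v) (latt w) :> R.
  by rewrite rdet_latt ltr0z.
split=> [[l [l0 ->]]|].
  have lv := l0 _ (@cone2l v w); have lw := l0 _ (@cone2r v w).
  have [ev|nv] := eqVneq ((l *m latt v) ord0 ord0) 0;
  have [ew|nw] := eqVneq ((l *m latt w) ord0 ord0) 0.
  - constructor 1; apply/seteqP; split=> [x []//|x sx]; split=> //.
    by have /cone2P[a [b [a0 b0 ->]]] := sx; rewrite !row_comb ev ew !mulr0 addr0.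
  - constructor 2; apply/seteqP; split=> x.
      move=> [/cone2P[a [b [a0 b0 ->]]]]; rewrite !row_comb ev mulr0 add0r => /eqP.
      rewrite mulf_eq0 (negPf nw) orbF => /eqP ->; apply/cone1P; exists a.
      by rewrite scale0r addr0.
    move=> /cone1P[a [a0 ->]]; split; last by rewrite rowZ ev mulr0.
    by apply/cone2P; exists a, 0; rewrite scale0r addr0.
  - constructor 3; apply/seteqP; split=> x.
      move=> [/cone2P[a [b [a0 b0 ->]]]]; rewrite !row_comb ew mulr0 addr0 => /eqP.
      rewrite mulf_eq0 (negPf nv) orbF => /eqP ->; apply/cone1P; exists b.
      by rewrite scale0r add0r.
    move=> /cone1P[a [a0 ->]]; split; last by rewrite rowZ ew mulr0.
    by apply/cone2P; exists 0, a; rewrite scale0r add0r.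
  - constructor 4; apply/seteqP; split=> x.
      move=> [/cone2P[a [b [a0 b0 ->]]]]; rewrite !row_comb => /eqP.
      rewrite paddr_eq0 ?mulr_ge0 // !mulf_eq0 (negPf nv) (negPf nw) !orbF.
      by move=> /andP[/eqP-> /eqP->]; rewrite !scale0r addr0.
    move=> ->; split; last by rewrite mulmx0 mxE.
    by apply/cone2P; exists 0, 0; rewrite !scale0r addr0.
(* These rows are the forms [rdet] with [v] and [rdet] with [w]: both are nonnegative on the cone,
   each vanishes on one bounding ray, and their sum vanishes only at the apex. *)
have rv (a b : R) : (row2 (- Y (latt v)) (X (latt v)) *m (a *: latt v + b *: latt w)) ord0 ord0
    = b * rdet (latt v) (latt w).
  by rewrite row2E /rdet !mxE; ring.
have rw (a b : R) : (row2 (Y (latt w)) (- X (latt w)) *m (a *: latt v + b *: latt w)) ord0 ord0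
    = a * rdet (latt v) (latt w).
  by rewrite row2E /rdet !mxE; ring.
case=> ->.
- exists 0; split=> [x _|]; first by rewrite mul0mx mxE.
  by apply/seteqP; split=> [x sx|x []//]; split=> //; rewrite mul0mx mxE.
- exists (row2 (- Y (latt v)) (X (latt v))); split.
    by move=> x /cone2P[a [b [a0 b0 ->]]]; rewrite rv mulr_ge0 // ltW.
  apply/seteqP; split=> x.
    move=> /cone1P[a [a0 ->]]; split; last by have := rv a 0; rewrite scale0r addr0 mul0r.
    by apply/cone2P; exists a, 0; rewrite scale0r addr0.
  move=> [/cone2P[a [b [a0 b0 ->]]]]; rewrite rv => /eqP; rewrite mulf_eq0.
  rewrite (gt_eqF dR) orbF => /eqP->; apply/cone1P; exists a.
  by rewrite scale0r addr0.
- exists (row2 (Y (latt w)) (- X (latt w))); split.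
    by move=> x /cone2P[a [b [a0 b0 ->]]]; rewrite rw mulr_ge0 // ltW.
  apply/seteqP; split=> x.
    move=> /cone1P[a [a0 ->]]; split; last by have := rw 0 a; rewrite scale0r add0r mul0r.
    by apply/cone2P; exists 0, a; rewrite scale0r add0r.
  move=> [/cone2P[a [b [a0 b0 ->]]]]; rewrite rw => /eqP; rewrite mulf_eq0.
  rewrite (gt_eqF dR) orbF => /eqP->; apply/cone1P; exists b.
  by rewrite scale0r add0r.
- exists (row2 (- Y (latt v)) (X (latt v)) + row2 (Y (latt w)) (- X (latt w))); split.
    move=> x /cone2P[a [b [a0 b0 ->]]]; rewrite mulmxDl mxE rv rw.
    by rewrite addr_ge0 // mulr_ge0 // ltW.
  apply/seteqP; split=> x.
    move=> ->; split; last by rewrite mulmx0 mxE.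
    by apply/cone2P; exists 0, 0; rewrite !scale0r addr0.
  move=> [/cone2P[a [b [a0 b0 ->]]]]; rewrite mulmxDl mxE rv rw => /eqP.
  rewrite paddr_eq0 ?mulr_ge0 // ?ltW // !mulf_eq0 (gt_eqF dR) !orbF.
  by move=> /andP[/eqP-> /eqP->]; rewrite !scale0r addr0.
Qed.

End Cones.

(** * Faces of polygons *)

Section NgonFaces.
Variables (R : realType) (V : seq 'cV[int]_2) (n p : 'cV[int]_2 -> 'cV[int]_2).
Hypothesis VP : ngon V n p.
Implicit Types (x y z : 'cV[R]_2) (l : 'rV[R]_2).
Let Vn := ngon_next VP.
Let Vp := ngon_prev VP.
Let nK := ngon_nextK VP.
Let pK := ngon_prevK VP.
Let Vdet := ngon_det VP.
Local Notation latt := (latt R).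
Local Notation edgef := (@edgef R).
Local Notation Q := (@conv R V).
Local Notation D v := ((det2 v (n v))%:~R : R).

Let D0 v : v \in V -> 0 < D v. Proof. by move=> /Vdet; rewrite ltr0z. Qed.

Lemma edgef_le x v : Q x -> v \in V -> edgef v (n v) x <= D v.
Proof. by move=> /(conv_ngonP VP) h /h. Qed.

Lemma conv_ngon_repr x : Q x -> exists v a b,
  [/\ v \in V, 0 <= a, 0 <= b, a + b <= 1 & x = a *: latt v + b *: latt (n v)].
Proof.
move=> Qx; have [v [a [b [vV a0 b0 e]]]] := ngon_coverV VP x.
exists v, a, b; split=> //; apply: (sum_le1 VP vV).
by rewrite -e; exact: edgef_le.
Qed.

Lemma edgef_eq x v : Q x -> v \in V -> edgef v (n v) x = D v -> conv [:: v; n v] x.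
Proof.
move=> Qx vV; have [w [a [b [wV a0 b0 ab ->]]]] := conv_ngon_repr Qx.
rewrite edgefD !edgefZ => e.
have h1 := ngon_supp_leR R VP vV wV; have h2 := ngon_supp_leR R VP vV (Vn wV).
have d0 := D0 vV.
(* The slack of [x] below the edge is a sum of three nonnegative terms, so equality kills each of
   them. *)
have [ab1 ha hb] : [/\ a + b = 1, a * (D v - edgef v (n v) (latt w)) = 0
    & b * (D v - edgef v (n v) (latt (n w))) = 0].
  have k1 : 0 <= a * (D v - edgef v (n v) (latt w)) by rewrite mulr_ge0 // subr_ge0.
  have k2 : 0 <= b * (D v - edgef v (n v) (latt (n w))) by rewrite mulr_ge0 // subr_ge0.
  have k3 : 0 <= (1 - a - b) * D v by apply: mulr_ge0; lra.
  have k4 : (1 - a - b) * D v = 0 by lra.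
  split; try lra.
  by move/eqP: k4; rewrite mulf_eq0 (gt_eqF d0) orbF => /eqP; lra.
have /convexP cP := @convex_conv R [:: v; n v].
have cv : conv [:: v; n v] (latt v) by apply: mem_conv; rewrite inE eqxx.
have cn : conv [:: v; n v] (latt (n v)) by apply: mem_conv; rewrite !inE eqxx orbT.
have cu u : u \in V -> D v - edgef v (n v) (latt u) = 0 -> conv [:: v; n v] (latt u).
  move=> uV /eqP; rewrite subr_eq0 eq_sym => /eqP e'.
  by have [->|->] := edgef_eqR VP vV uV e'.
move/eqP: ha; rewrite mulf_eq0 => /orP[/eqP a00|/eqP ha].
  have b1 : b = 1 by lra.
  move: hb; rewrite a00 b1 mul1r => /cu -/(_ (Vn wV)).
  by rewrite scale0r add0r scale1r.
move/eqP: hb; rewrite mulf_eq0 => /orP[/eqP b00|/eqP hb].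
  have a1 : a = 1 by lra.
  by rewrite a1 b00 scale0r addr0 scale1r; exact: cu.
by apply: cP => //; apply: cu => //; exact: Vn.
Qed.

Lemma edgef_vertex x v : Q x -> v \in V -> edgef v (n v) x = D v ->
  edgef (p v) v x = (det2 (p v) v)%:~R -> x = latt v.
Proof.
move=> Qx vV e1 e2; have /conv2P[a [b [a0 b0 ab ex]]] := edgef_eq Qx vV e1.
have ep := edgef_r R (p v) v.
have h : edgef (p v) v (latt (n v)) < (det2 (p v) v)%:~R.
  rewrite edgef_latt ltr_int.
  have := ngon_supp VP (Vp vV) (Vn vV); rewrite pK //; apply.
    exact: (next_neq_prev VP).
  exact: (next_neq VP).
have b00 : b = 0.
  apply/eqP; rewrite eq_le b0 andbT leNgt; apply/negP => b00.
  move: e2; rewrite ex edgefD !edgefZ ep => e2.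
  have a1 : a = 1 - b by lra.
  by move: e2; rewrite a1; move: h b00; nra.
have a1 : a = 1 by lra.
by rewrite ex b00 a1 scale0r addr0 scale1r.
Qed.

Definition edgerow v w : 'rV[R]_2 :=
  row2 (Y (latt w) - Y (latt v)) (X (latt v) - X (latt w)).

Lemma edgerowE v w x : (edgerow v w *m x) ord0 ord0 = edgef v w x.
Proof. by rewrite row2E /edgef /rdet; ring. Qed.

Lemma row_neq0 l x : (l *m x) ord0 ord0 != 0 -> l != 0.
Proof. by apply: contraNneq => ->; rewrite mul0mx mxE. Qed.

Lemma conv_edge_sub v : v \in V -> conv [:: v; n v] `<=` Q.
Proof.
by move=> vV; apply: sub_conv => u; rewrite !inE => /orP[]/eqP-> //; exact: Vn.
Qed.

Lemma edge_proper v : v \in V -> proper_face Q (conv [:: v; n v]).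
Proof.
move=> vV; split; first by exists (latt v); apply: mem_conv; rewrite inE eqxx.
exists (edgerow v (n v)), (D v); split.
- apply: (@row_neq0 _ (latt v)).
  by rewrite edgerowE edgef_l gt_eqF // D0.
- by move=> x Qx; rewrite edgerowE edgef_le.
- apply/seteqP; split=> x.
    move=> cx; split; first exact: conv_edge_sub cx.
    have /conv2P[a [b [_ _ ab ->]]] := cx.
    by rewrite edgerowE edgef_comb ab mul1r.
  by move=> [Qx]; rewrite edgerowE; exact: edgef_eq.
Qed.

Lemma edge_conv v : v \in V -> edge Q (conv [:: v; n v]).
Proof.
move=> vV; split; first exact: edge_proper.
exists (latt v), (latt (n v)); split; try by apply: mem_conv; rewrite !inE eqxx ?orbT.
by apply: contra_neq (next_neq VP vV) => /latt_inj <-.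
Qed.

(** The sum of the two edge functionals at [v] supports the polygon exactly at [v], since it attains
    its bound only where both of them do. *)
Lemma vertex_conv v : v \in V -> vertices Q (latt v).
Proof.
move=> vV; split; first by exists (latt v).
have ep x : Q x -> edgef (p v) v x <= (det2 (p v) v)%:~R.
  by move=> Qx; have := edgef_le Qx (Vp vV); rewrite pK.
have dp : 0 < (det2 (p v) v)%:~R :> R by rewrite ltr0z (ngon_detp VP).
have epv : edgef (p v) v (latt v) = (det2 (p v) v)%:~R.
  exact: edgef_r.
have rE x : ((edgerow v (n v) + edgerow (p v) v) *m x) ord0 ord0
   = edgef v (n v) x + edgef (p v) v x by rewrite mulmxDl mxE !edgerowE.
exists (edgerow v (n v) + edgerow (p v) v), (D v + (det2 (p v) v)%:~R); split.
- apply: (@row_neq0 _ (latt v)).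
  by rewrite rE epv edgef_l gt_eqF // addr_gt0 // D0.
- by move=> x Qx; rewrite rE lerD ?ep // edgef_le.
- apply/seteqP; split=> x.
    by move=> ->; rewrite /= rE epv edgef_l; split=> //; exact: mem_conv.
  move=> [Qx]; rewrite rE => e; have h1 := ep _ Qx; have h2 := edgef_le Qx vV.
  by apply: edgef_vertex => //; lra.
Qed.

(** The gradient of [l], seen as a point, has a positive value and lies in the cone of some edge, so
    [l] is positive at one end of that edge. *)
Lemma face_height l c : l != 0 -> (forall x, Q x -> (l *m x) ord0 ord0 <= c) -> 0 < c.
Proof.
move=> l0 h.
pose z : 'cV[R]_2 := l^T.
have z0 : 0 < (l *m z) ord0 ord0.
  rewrite mul_row_col2 !mxE; rewrite lt_neqAle addr_ge0 -?expr2 ?sqr_ge0 // andbT eq_sym.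
  apply: contra_neq l0 => /eqP; rewrite paddr_eq0 ?sqr_ge0 // !sqrf_eq0.
  move=> /andP[/eqP e1 /eqP e2]; apply: trmx_inj.
  by apply: col2P; rewrite !mxE.
have [v [a [b [vV a0 b0 e]]]] := ngon_coverV VP z.
have h1 := h _ (mem_conv vV); have h2 := h _ (mem_conv (Vn vV)).
move: z0; rewrite e !row_comb => z0.
have k1 := ler_wpM2l a0 h1; have k2 := ler_wpM2l b0 h2.
rewrite ltNge; apply/negP => c0; nra.
Qed.

(** The positive height of the face rules out any weight on the origin, so the point lies on an
    edge; an end that carries weight must attain the maximum too. *)
Lemma face_repr l c x : l != 0 -> (forall x, Q x -> (l *m x) ord0 ord0 <= c) ->
  Q x -> (l *m x) ord0 ord0 = c ->
  exists v a b, [/\ v \in V, 0 <= a, 0 <= b & a + b = 1] /\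
    [/\ x = a *: latt v + b *: latt (n v),
        a != 0 -> (l *m latt v) ord0 ord0 = c
      & b != 0 -> (l *m latt (n v)) ord0 ord0 = c].
Proof.
move=> l0 h Qx; have c0 := face_height l0 h.
have [v [a [b [vV a0 b0 ab ex]]]] := conv_ngon_repr Qx.
have h1 := h _ (mem_conv vV); have h2 := h _ (mem_conv (Vn vV)).
rewrite {1}ex !row_comb => e.
have k1 : 0 <= a * (c - (l *m latt v) ord0 ord0) by rewrite mulr_ge0 // subr_ge0.
have k2 : 0 <= b * (c - (l *m latt (n v)) ord0 ord0) by rewrite mulr_ge0 // subr_ge0.
have k3 : 0 <= (1 - a - b) * c by apply: mulr_ge0; lra.
have k4 : (1 - a - b) * c = 0 by lra.
have ab1 : a + b = 1.
  by move/eqP: k4; rewrite mulf_eq0 (gt_eqF c0) orbF => /eqP; lra.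
exists v, a, b; split; split=> //.
  move=> an0; have /eqP : a * (c - (l *m latt v) ord0 ord0) = 0 by lra.
  by rewrite mulf_eq0 (negPf an0) subr_eq0 => /eqP.
move=> bn0; have /eqP : b * (c - (l *m latt (n v)) ord0 ord0) = 0 by lra.
by rewrite mulf_eq0 (negPf bn0) subr_eq0 => /eqP.
Qed.

Lemma verticesE : vertices Q = latt @` [set` V].
Proof.
apply/seteqP; split=> x; last by move=> [v vV <-]; exact: vertex_conv.
move=> [_ [l [c [l0 h E]]]].
have [Qx lx] : Q x /\ (l *m x) ord0 ord0 = c.
  by have : [set x] x by []; rewrite [X in X x]E.
have [v [a [b [[vV a0 b0 ab] [ex ha hb]]]]] := face_repr l0 h Qx lx.
have inF y : Q y -> (l *m y) ord0 ord0 = c -> y = x.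
  by move=> Qy ly; have : [set x] y by rewrite E.
have [aE|an0] := eqVneq a 0.
  exists (n v); first exact: Vn.
  by apply: inF; [apply: mem_conv; exact: Vn|apply: hb; move: ab; rewrite aE add0r => ->; exact: oner_neq0].
by exists v => //; apply: inF; [exact: mem_conv|exact: ha].
Qed.

Lemma edgeP F : edge Q F -> exists2 v, v \in V & F = conv [:: v; n v].
Proof.
move=> [[_ [l [c [l0 h FE]]]] [x [y [Fx Fy xy]]]].
have [Qx lx] : Q x /\ (l *m x) ord0 ord0 = c by move: Fx; rewrite FE.
have [Qy ly] : Q y /\ (l *m y) ord0 ord0 = c by move: Fy; rewrite FE.
(* The midpoint of two distinct points of [F] is not a vertex, so both ends of the edge through it
   carry weight and therefore lie in [F]. *)
pose z := 2^-1 *: x + 2^-1 *: y.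
have Qz : Q z.
  have /convexP cP := @convex_conv R V.
  by apply: cP => //; lra.
have lz : (l *m z) ord0 ord0 = c by rewrite !row_comb lx ly; lra.
have [v [a [b [[vV a0 b0 ab] [ez ha hb]]]]] := face_repr l0 h Qz lz.
have notvtx u : u \in V -> z = latt u -> False.
  move=> uV eu.
  have half g (gD : forall x y, g (x + y) = g x + g y)
      (gZ : forall a x, g (a *: x) = a * g x) (d : R) :
      g x <= d -> g y <= d -> g z = d -> g x = d /\ g y = d.
    by rewrite /z gD !gZ => gx gy e; split; lra.
  have [ex1 ey1] := half _ (edgefD u (n u)) (edgefZ u (n u)) (D u)
    (edgef_le Qx uV) (edgef_le Qy uV) (etrans (congr1 _ eu) (edgef_l R u (n u))).
  have [ex2 ey2] : edgef (p u) u x = (det2 (p u) u)%:~R /\ edgef (p u) u y = (det2 (p u) u)%:~R.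
    have := half _ (edgefD (p u) (n (p u))) (edgefZ (p u) (n (p u))) (D (p u))
      (edgef_le Qx (Vp uV)) (edgef_le Qy (Vp uV)).
    by rewrite eu pK //; apply; exact: edgef_r.
  move/eqP: xy; apply.
  by rewrite (edgef_vertex Qx uV ex1 ex2) (edgef_vertex Qy uV ey1 ey2).
have an0 : a != 0.
  apply/eqP => aE; apply: (notvtx (n v)); first exact: Vn.
  have bE : b = 1 by lra.
  by rewrite ez aE bE scale0r add0r scale1r.
have bn0 : b != 0.
  apply/eqP => bE; apply: (notvtx v) => //.
  have aE : a = 1 by lra.
  by rewrite ez aE bE scale0r addr0 scale1r.
exists v => //; rewrite FE; apply/seteqP; split=> t.
  move=> [Qt lt]; apply: edgef_eq => //.
  (* Both [l] and the edge functional take equal values at the two ends, so they are proportional,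
     and [t] is tight for one because it is tight for the other. *)
  have et := rdet_cramer t (Vdet vV).
  have d0 := D0 vV; have c0 := face_height l0 h.
  move: lt; rewrite et !row_comb ha // hb // edgef_comb -mulrDl => e.
  by rewrite -[RHS]mul1r; congr (_ * _); apply: (mulIf (lt0r_neq0 c0)); rewrite mul1r.
move=> ct; split; first exact: conv_edge_sub ct.
have /conv2P[e [f [_ _ ef ->]]] := ct.
by rewrite !row_comb ha // hb // -mulrDl ef mul1r.
Qed.

Lemma fixed_pointsE : fixed_points Q = (fun v => (v, n v)) @` [set` V].
Proof.
apply/seteqP; split=> [[a b] [/= eab d]|_ [v vV <-]]; last first.
  by split=> /=; [exact: edge_conv|exact: Vdet].
have [v vV E] := edgeP eab.
by have [<- <-] := conv2_inj d (Vdet vV) E; exists v.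
Qed.

Lemma singular_pointsE : singular_points Q =
  (fun v => (v, n v)) @` [set` [seq v <- V | 2 <= det2 v (n v)]].
Proof.
apply/seteqP; split=> [ab []|_ [v + <-]].
  rewrite fixed_pointsE => -[v vV <-] /= d; exists v => //=.
  by rewrite mem_filter d.
by rewrite /= mem_filter => /andP[d vV]; split=> //; rewrite fixed_pointsE; exists v.
Qed.

Lemma card_fset_image (T U : choiceType) (f : T -> U) (s : seq T) :
  injective f -> uniq s -> #|` fset_set (f @` [set` s])| = size s.
Proof.
move=> fI sU; rewrite fset_set_image; last exact: finite_seq.
rewrite card_imfset //= .
have -> : fset_set [set` s] = [fset x in s]%fset.
  apply/fsetP => x; rewrite in_fset_set; last exact: finite_seq.
  by rewrite !inE /=; apply/idP/idP => [/set_mem|?]//; apply/mem_set.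
by rewrite card_fseq undup_id.
Qed.

Lemma nb_singular_pointsE :
  nb_singular_points Q = count (fun v => 2 <= det2 v (n v)) V.
Proof.
rewrite /nb_singular_points singular_pointsE card_fset_image ?size_filter //.
  by move=> v w [].
by rewrite filter_uniq // (ngon_uniq VP).
Qed.

Lemma picard_numberE : picard_number Q = (size V - 2)%N.
Proof.
rewrite /picard_number verticesE card_fset_image //; first exact: latt_inj.
exact: ngon_uniq VP.
Qed.

Lemma fan_ofP tau : fan_of Q tau <->
  [\/ exists2 v, v \in V & tau = cone_over (conv [:: v; n v]),
      exists2 v, v \in V & tau = cone_over (conv [:: v]) | tau = [set 0]].
Proof.
split.
  move=> [F /edgeP[v vV ->]] /(cone_face2P _ (Vdet vV))[] ->.
  - by constructor 1; exists v.
  - by constructor 2; exists v.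
  - by constructor 2; exists (n v) => //; exact: Vn.
  - by constructor 3.
case=> [[v vV ->]|[v vV ->]|->].
- by exists (conv [:: v; n v]); [exact: edge_conv|apply/cone_face2P; [exact: Vdet|constructor 1]].
- by exists (conv [:: v; n v]); [exact: edge_conv|apply/cone_face2P; [exact: Vdet|constructor 2]].
- case: V (ngon_neq0 VP) (@edge_conv) Vdet => // v W _ h hd.
  have vW : v \in v :: W by rewrite inE eqxx.
  by exists (conv [:: v; n v]); [exact: h|apply/cone_face2P; [exact: hd|constructor 4]].
Qed.

End NgonFaces.

(** * Gift wrapping *)

Lemma ngon_interior (R : realType) V n p : ngon V n p -> interior (@conv R V) 0.
Proof.
move=> VP; rewrite /interior /=.
suff : \forall x \near (0 : 'cV[R]_2),
    {in V, forall v, edgef v (n v) x <= (det2 v (n v))%:~R}.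
  by apply: filterS => x h; apply/(conv_ngonP VP).
(* The list of edges is generalised for the induction, because a tail of [V] need not be closed
   under [n]. *)
suff H (W : seq 'cV[int]_2) : {subset W <= V} -> \forall x \near (0 : 'cV[R]_2),
    {in W, forall v, edgef v (n v) x <= (det2 v (n v))%:~R} by exact: H.
elim: W => [|v W IH] sW; first by near=> x.
have {}IH : \forall x \near (0 : 'cV[R]_2),
    {in W, forall v, edgef v (n v) x <= (det2 v (n v))%:~R}.
  by apply: IH => u uW; rewrite sW // inE uW orbT.
have vV : v \in V by rewrite sW // inE eqxx.
have hv : \forall x \near (0 : 'cV[R]_2), edgef v (n v) x < (det2 v (n v))%:~R.
  have cv : edgef v (n v) x @[x --> (0 : 'cV[R]_2)] --> edgef v (n v) 0.
    have -> : edgef v (n v) = (fun x : 'cV[R]_2 =>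
        X x * (Y (latt R (n v)) - Y (latt R v)) + Y x * (X (latt R v) - X (latt R (n v)))).
      by apply/funext => x; rewrite /edgef /rdet; ring.
    have hX := @coord_continuous R 2 1 ord0 ord0 (0 : 'cV[R]_2).
    have hY := @coord_continuous R 2 1 ord_max ord0 (0 : 'cV[R]_2).
    exact: (cvgD (cvgM hX (cvg_cst _)) (cvgM hY (cvg_cst _))).
  apply: (cvgr_lt _ cv).
  rewrite -(scale0r (0 : 'cV[R]_2)) edgefZ mul0r ltr0z.
  exact: ngon_det VP _ vV.
near=> x => u; rewrite inE => /orP[/eqP->|uW].
  by apply: ltW; near: x; exact: hv.
by move: u uW; near: x; exact: IH.
Unshelve. all: by end_near. Qed.

Section Wrapping.
Variable R : realType.
Local Notation lin a b u := (a * (X u)%:~R + b * (Y u)%:~R : R).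

Definition exposed (s : seq 'cV[int]_2) v :=
  exists a b : R, forall u, u \in s -> u != v -> lin a b u < lin a b v.

(** Interiority of the origin in the form that gift wrapping uses: every supporting line of [s] has
    positive height. *)
Definition zero_inside (s : seq 'cV[int]_2) := forall a b c : R,
  (a != 0) || (b != 0) -> (forall u, u \in s -> lin a b u <= c) -> 0 < c.

Lemma int_col2_neq v w : v != w -> (X v != X w) || (Y v != Y w).
Proof.
by apply: contraR; rewrite negb_or !negbK => /andP[/eqP eX /eqP eY]; apply/eqP/col2P.
Qed.

Lemma lin_edge v w u :
  lin (Y w - Y v)%:~R (X v - X w)%:~R u = (det2 u w + det2 v u)%:~R.
Proof. by rewrite -!intrM -intrD /det2; congr (_%:~R); ring. Qed.

Lemma zero_inside_ex_neq s v : zero_inside s -> exists2 u, u \in s & u != v.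
Proof.
move=> s0; apply/not_exists2P => h.
have sv u : u \in s -> u = v.
  by move=> us; have [//|/negP] := h u; case; last case: eqP => // ->.
have [e|] := eqVneq v 0.
  suff : (0 : R) < 0 by rewrite ltxx.
  apply: (s0 1 0); rewrite ?oner_neq0 // => u /sv ->.
  by rewrite e !mxE !mulr0 addr0.
move=> /int_col2_neq; rewrite !mxE => v0.
suff : (0 : R) < 0 by rewrite ltxx.
apply: (s0 (Y v)%:~R (- (X v)%:~R)); first by rewrite oppr_eq0 !intr_eq0 orbC.
by move=> u /sv ->; rewrite le_eqVlt; apply/orP; left; apply/eqP; ring.
Qed.

(** The point farthest from the origin is exposed by its own position vector: any other point,
    having no larger norm, has a smaller scalar product with it. *)
Lemma exposed_ex s : zero_inside s -> exists2 v, v \in s & exposed s v.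
Proof.
move=> s0; have sn : s != [::].
  by have [u + _] := zero_inside_ex_neq 0 s0; case: (s).
have [v vs vmax] := seq_argmax (fun u => X u * X u + Y u * Y u) sn.
exists v => //; exists (X v)%:~R, (Y v)%:~R => u us uv.
rewrite -!intrM -!intrD ltr_int; have := vmax u us => /=.
have : 0 < (X u - X v) ^+ 2 + (Y u - Y v) ^+ 2.
  rewrite lt_neqAle addr_ge0 ?sqr_ge0 // andbT eq_sym paddr_eq0 ?sqr_ge0 //.
  by rewrite !sqrf_eq0 !subr_eq0 negb_and int_col2_neq.
move: vmax us => _ _; rewrite !expr2. move: (u ord0 ord0) (u ord_max ord0) (v ord0 ord0) (v ord_max ord0) => a b c d; nia.
Qed.

(* Gift wrapping: [w] is the first point of [s] met by a line rotating
   counterclockwise around [v], and the farthest one on that line. *)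
Lemma next_ex s v : zero_inside s -> v \in s -> exposed s v -> exists w,
  [/\ w \in s, exposed s w, 0 < det2 v w,
      forall u, u \in s -> det2 u w + det2 v u <= det2 v w
    & forall u, u \in s -> exposed s u -> u != v -> u != w ->
        det2 u w + det2 v u < det2 v w].
Proof.
move=> s0 vs [a [b vexp]].
(* [h u] is the depth of [u] below the supporting line at [v] and [k u] its displacement along that
   line, so [k u / h u] orders the points by their direction seen from [v]. *)
pose h u : R := lin a b v - lin a b u.
pose k u : R := lin (- b) a u - lin (- b) a v.
have h0 u : u \in s -> u != v -> 0 < h u by move=> us uv; rewrite subr_gt0 vexp.
have [u0 u0s u0v] := zero_inside_ex_neq v s0.
have N0 : 0 < a * a + b * b.
  rewrite lt_neqAle eq_sym addr_ge0 -?expr2 ?sqr_ge0 // andbT.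
  rewrite paddr_eq0 ?sqr_ge0 // !sqrf_eq0; apply/negP => /andP[/eqP a0 /eqP b0].
  by have := vexp _ u0s u0v; rewrite a0 b0 !mul0r ltxx.
(* Up to a positive factor, the slack of the edge functional compares the slopes of [u] and [w]. *)
have hk u w : (det2 u w + det2 v u - det2 v w)%:~R * (a * a + b * b)
    = h w * k u - k w * h u.
  by rewrite /det2 /h /k; ring.
pose s1 := [seq u <- s | u != v].
have s1P u : (u \in s1) = (u != v) && (u \in s) by rewrite mem_filter.
have s1n : s1 != [::].
  by apply/eqP => e; have := s1P u0; rewrite u0s u0v e.
have [w1 w1s w1max] := seq_argmax (fun u => k u / h u) s1n.
pose s2 := [seq u <- s1 | k u / h u == k w1 / h w1].
have s2n : s2 != [::].
  by apply/eqP => e; have : w1 \in s2 by [rewrite mem_filter eqxx]; rewrite e.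
have [w ws2 wmax] := seq_argmax h s2n.
move: ws2; rewrite mem_filter s1P => /and3P[/eqP wr wv ws].
have hw := h0 _ ws wv.
have slope u : u \in s -> u != v -> h w * k u <= k w * h u.
  move=> us uv; have hu := h0 _ us uv.
  have : k u / h u <= k w / h w by rewrite wr; apply: w1max; rewrite s1P uv.
  by rewrite ler_pdivrMr // mulrAC ler_pdivlMr // mulrC.
have far u : u \in s -> u != v -> h w * k u = k w * h u -> h u <= h w.
  move=> us uv e; have hu := h0 _ us uv; apply: wmax.
  rewrite mem_filter s1P uv us andbT andbT -wr.
  by rewrite (eqr_div _ _ (lt0r_neq0 hu) (lt0r_neq0 hw)) [_ * h w]mulrC e.
have hv : h v = 0 by rewrite /h subrr.
have kv : k v = 0 by rewrite /k subrr.
have supp u : u \in s -> det2 u w + det2 v u <= det2 v w.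
  move=> us; rewrite -subr_le0 -(ler_int R) -(ler_pM2r N0) hk mul0r subr_le0.
  by have [->|uv] := eqVneq u v; [rewrite hv kv !mulr0|exact: slope].
have flat u : u \in s -> det2 u w + det2 v u = det2 v w -> h w * k u = k w * h u.
  by move=> us e; apply/eqP; rewrite -subr_eq0 -hk e subrr mul0r.
have hk_inj u u' : h u = h u' -> k u = k u' -> u = u'.
  move=> eh ek; have [//|/int_col2_neq/orP] := eqVneq u u'.
  have eX : (a * a + b * b) * ((X u)%:~R - (X u')%:~R) = 0.
    transitivity (- a * (h u - h u') - b * (k u - k u')); first by rewrite /h /k; ring.
    by rewrite eh ek; ring.
  have eY : (a * a + b * b) * ((Y u)%:~R - (Y u')%:~R) = 0.
    transitivity (- b * (h u - h u') + a * (k u - k u')); first by rewrite /h /k; ring.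
    by rewrite eh ek; ring.
  move/eqP: eX; move/eqP: eY; rewrite !mulf_eq0 (gt_eqF N0) /= !subr_eq0 !eqr_int.
  by move=> /eqP -> /eqP ->; rewrite !eqxx; case.
have farw u : u \in s -> u != v -> u != w -> h w * k u = k w * h u -> h u < h w.
  move=> us uv uw e; rewrite lt_neqAle far // andbT; apply/eqP => eh.
  move/eqP: uw; apply; apply: hk_inj => //.
  by apply: (mulfI (lt0r_neq0 hw)); rewrite e eh mulrC.
exists w; split=> //.
- have sn : s != [::] by apply: contraTneq ws => ->.
  have [m ms mmax] := seq_argmax h sn.
  (* A large multiple of the edge functional minus the form that exposes [v]. Off the line through
     [v] and [w] the integral edge functional drops by at least 1, and the factor [h m], the
     greatest depth, outweighs [h u]; on the line the depth decides, and [w] is the deepest. *)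
  exists (h m * (Y w - Y v)%:~R - a), (h m * (X v - X w)%:~R - b) => u us uw.
  have linE (z : 'cV[int]_2) : lin (h m * (Y w - Y v)%:~R - a) (h m * (X v - X w)%:~R - b) z
      = h m * (det2 z w + det2 v z)%:~R + (h z - lin a b v).
    by rewrite -lin_edge /h; ring.
  rewrite !linE det2vv add0r.
  have hm : h u <= h m := mmax u us.
  have hm0 : 0 < h m := lt_le_trans hw (mmax w ws).
  have [->|uv] := eqVneq u v.
    by rewrite det2vv addr0 hv; lra.
  have [e|ne] := eqVneq (det2 u w + det2 v u) (det2 v w).
    by rewrite e; have := farw _ us uv uw (flat _ us e); lra.
  have : det2 u w + det2 v u + 1 <= det2 v w by rewrite lezD1 lt_neqAle ne supp.
  rewrite -(ler_int R) [in leLHS]intrD => le1.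
  have := ler_wpM2l (ltW hm0) le1; rewrite mulrDr mulr1 => le2; clear -le2 hw hm; clearbody h; lra.
- rewrite -(ltr0z R); apply: (s0 (Y w - Y v)%:~R (X v - X w)%:~R).
    by rewrite !intr_eq0 !subr_eq0 orbC eq_sym; move/int_col2_neq: wv; rewrite [Y w == _]eq_sym [X w == _]eq_sym.
  by move=> u us; rewrite lin_edge ler_int supp.
(* An exposed point on that line would lie strictly between [v] and [w], where no linear form has a
   strict maximum. *)
- move=> u us [a' [b' uexp]] uv uw; rewrite lt_neqAle supp // andbT.
  apply/eqP => e; have fl := flat _ us e.
  have hu := h0 _ us uv; have huw := farw _ us uv uw fl.
  have c1 := uexp _ vs; have c2 := uexp _ ws.
  rewrite eq_sym in uv; rewrite eq_sym in uw.
  have {}c1 := c1 uv; have {}c2 := c2 uw.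
  have eX : (a * a + b * b) * (((X u)%:~R - (X v)%:~R) * h w - ((X w)%:~R - (X v)%:~R) * h u) = 0.
    transitivity (- b * (h w * k u - k w * h u)); first by rewrite /h /k; ring.
    by rewrite fl subrr mulr0.
  have eY : (a * a + b * b) * (((Y u)%:~R - (Y v)%:~R) * h w - ((Y w)%:~R - (Y v)%:~R) * h u) = 0.
    transitivity (a * (h w * k u - k w * h u)); first by rewrite /h /k; ring.
    by rewrite fl subrr mulr0.
  move/eqP: eX; move/eqP: eY; rewrite !mulf_eq0 (gt_eqF N0) /= !subr_eq0.
  move=> /eqP eY /eqP eX.
  have : h w * lin a' b' u = (h w - h u) * lin a' b' v + h u * lin a' b' w.
    transitivity (h w * lin a' b' v + a' * (((X u)%:~R - (X v)%:~R) * h w)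
        + b' * (((Y u)%:~R - (Y v)%:~R) * h w)); first by ring.
    by rewrite eX eY; ring.
  have k1 : 0 < h w - h u by rewrite subr_gt0.
  have := ltr_pM2l k1 (lin a' b' v) (lin a' b' u); rewrite c1 => k2.
  have := ltr_pM2l hu (lin a' b' w) (lin a' b' u); rewrite c2 => k3.
  move: k2 k3; lra.
Qed.

End Wrapping.

(** * From a hull with the origin inside to a cyclically ordered polygon *)

Section Polygon.
Variable R : realType.
Implicit Types Q : set 'cV[R]_2.
Local Notation lin a b u := (a * (X u)%:~R + b * (Y u)%:~R : R).

Lemma interior_zero_inside s : interior (@conv R s) 0 -> zero_inside R s.
Proof.
move=> /nbhs_ballP[d /= d0 dQ] a b c ab h.
pose z : 'cV[R]_2 := \col_i [:: a; b]`_i.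
have hQ x : conv s x -> (row2 a b *m x) ord0 ord0 <= c.
  move: x; apply: (@conv_sub R s [set x | (row2 a b *m x) ord0 ord0 <= c]).
    by apply: (@convex_le R (fun x => (row2 a b *m x) ord0 ord0)); [exact: rowD|exact: rowZ].
  by move=> u us; rewrite /= row2E !lattE; exact: h.
(* Scales [z] into the ball; the form is positive there because its value at [z] is a^2 + b^2. *)
pose e := d / 2 / (1 + `|z|).
have z1 : 0 < 1 + `|z| by rewrite ltr_pwDl.
have e0 : 0 < e by rewrite !divr_gt0.
have Qz : conv s (e *: z).
  apply: dQ; rewrite -ball_normE /= sub0r normrN normrZ gtr0_norm // /e.
  rewrite mulrAC ltr_pdivrMr //; have := normr_ge0 z; nra.
apply: lt_le_trans (hQ _ Qz); rewrite rowZ row2E !mxE /= mulr_gt0 //.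
rewrite lt_neqAle addr_ge0 -?expr2 ?sqr_ge0 // andbT eq_sym.
by rewrite paddr_eq0 ?sqr_ge0 // !sqrf_eq0 negb_and.
Qed.

(** A reflection reverses the orientation, so wrapping the mirror image counterclockwise produces
    predecessors. *)
Definition mirror u : 'cV[int]_2 := vec2 (X u) (- Y u).

Lemma mirrorK : involutive mirror.
Proof. by move=> u; apply: col2P; rewrite !vec2E // opprK. Qed.

Lemma det2_mirror u v : det2 (mirror u) (mirror v) = det2 v u.
Proof. by rewrite /det2 !vec2E; ring. Qed.

Lemma mem_mirror s u : (mirror u \in [seq mirror v | v <- s]) = (u \in s).
Proof. by rewrite mem_map //; exact: can_inj mirrorK. Qed.

Lemma zero_inside_mirror s :
  zero_inside R s -> zero_inside R [seq mirror v | v <- s].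
Proof.
move=> h a b c ab hs; apply: (h a (- b)); first by rewrite oppr_eq0.
move=> u us; have := hs (mirror u); rewrite mem_mirror => /(_ us).
by rewrite !vec2E rmorphN mulrN mulNr.
Qed.

Lemma exposed_mirror s v :
  exposed R s v -> exposed R [seq mirror u | u <- s] (mirror v).
Proof.
move=> [a [b h]]; exists a, (- b) => u; rewrite -(mirrorK u) mem_mirror => us uv.
have := h _ us; rewrite !vec2E !rmorphN !mulrNN; apply.
by apply: contraNneq uv => ->.
Qed.

Lemma mirror_exposed s v :
  exposed R [seq mirror u | u <- s] (mirror v) -> exposed R s v.
Proof.
by move=> /exposed_mirror; rewrite mapK ?mirrorK //; exact: mirrorK.
Qed.

Lemma prev_ex s v : zero_inside R s -> v \in s -> exposed R s v -> exists w,
  [/\ w \in s, exposed R s w, 0 < det2 w v &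
    forall u, u \in s -> exposed R s u -> u != w -> u != v ->
        det2 u v + det2 w u < det2 w v].
Proof.
move=> /zero_inside_mirror s0 vs /exposed_mirror vexp.
have vs' : mirror v \in [seq mirror u | u <- s] by rewrite mem_mirror.
have [w [ws wexp d _ h]] := next_ex s0 vs' vexp.
move: ws wexp d h; rewrite -(mirrorK w) mem_mirror => ws wexp.
move: (mirror w) ws wexp => {}w ws /mirror_exposed wexp; rewrite det2_mirror => d h.
exists w; split=> // u us uexp uw uv.
have := h (mirror u); rewrite mem_mirror !det2_mirror addrC; apply=> //.
- exact: exposed_mirror.
- by rewrite (can_eq mirrorK).
- by rewrite (can_eq mirrorK).
Qed.

Lemma partial_choice (T : eqType) (P : T -> T -> Prop) (s : seq T) :
  (forall x, x \in s -> exists y, P x y) ->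
  exists f, forall x, x \in s -> P x (f x).
Proof.
move=> h; have [f hf] : {f : T -> T & forall x, x \in s -> P x (f x)}.
  apply: (@choice _ _ (fun x y => x \in s -> P x y)) => x.
  (* Outside [s] the argument itself is the default value. *)
  by have [/h[y Pw]|_] := boolP (x \in s); [exists y|exists x].
by exists f.
Qed.

Lemma conv_ngon s : interior (@conv R s) 0 ->
  exists V n p, ngon V n p /\ @conv R s = conv V.
Proof.
move=> /interior_zero_inside s0.
pose V := [seq v <- undup s | `[< exposed R s v >]].
have VE v : (v \in V) <-> (v \in s /\ exposed R s v).
  rewrite mem_filter mem_undup; split=> [/andP[/asboolP ? ?]|[vs ve]] //.
  by apply/andP; split=> //; apply/asboolP.
have [n nP] : exists n, forall v, v \in V ->
  [/\ n v \in V, 0 < det2 v (n v),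
      forall u, u \in s -> det2 u (n v) + det2 v u <= det2 v (n v)
    & forall u, u \in V -> u != v -> u != n v -> det2 u (n v) + det2 v u < det2 v (n v)].
  apply: (@partial_choice _ (fun v w => [/\ w \in V, 0 < det2 v w,
     forall u, u \in s -> det2 u w + det2 v u <= det2 v w
    & forall u, u \in V -> u != v -> u != w -> det2 u w + det2 v u < det2 v w])).
  move=> v /VE[vs vexp]; have [w [ws wexp d h1 h2]] := next_ex s0 vs vexp.
  by exists w; split=> // [|u /VE[us uexp]]; [apply/VE|exact: h2].
have [p pP] : exists p, forall v, v \in V -> [/\ p v \in V, 0 < det2 (p v) v
    & forall u, u \in V -> u != p v -> u != v -> det2 u v + det2 (p v) u < det2 (p v) v].
  apply: (@partial_choice _ (fun v w => [/\ w \in V, 0 < det2 w v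
    & forall u, u \in V -> u != w -> u != v -> det2 u v + det2 w u < det2 w v])).
  move=> v /VE[vs vexp]; have [w [ws wexp d h2]] := prev_ex s0 vs vexp.
  by exists w; split=> // [|u /VE[us uexp]]; [apply/VE|exact: h2].
have dneq u v : 0 < det2 u v -> u != v.
  by apply: contraTneq => ->; rewrite det2vv.
have VP : ngon V n p.
  split.
  - by rewrite filter_uniq // undup_uniq.
  - by have [v vs vexp] := exposed_ex s0; apply/eqP => e; have := (VE v).2 (conj vs vexp); rewrite e.
  - by move=> v /nP[].
  - by move=> v /pP[].
  (* [n] and [p] were chosen independently. If [p (n v)] differed from [v], each of the two edges
     ending at [n v] would lie strictly above the start of the other, and the two inequalities add
     up to 0 < 0. *)
  - move=> v vV; have [nV d _ h] := nP _ vV; have [pV d' h'] := pP _ nV.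
    apply/eqP/negPn/negP => e.
    have k1 := h _ pV e (dneq _ _ d').
    by have := h' _ vV; rewrite eq_sym e (dneq _ _ d) => /(_ isT isT); have := det2C v (p (n v)); lia.
  - move=> v vV; have [pV d' h'] := pP _ vV; have [nV d _ h] := nP _ pV.
    apply/eqP/negPn/negP => e.
    have e2 : n (p v) != p v by rewrite eq_sym dneq.
    have k1 := h' _ nV e2 e.
    by have := h _ vV; rewrite eq_sym dneq // eq_sym e => /(_ isT isT); have := det2C v (n (p v)); lia.
  - by move=> v /nP[].
  - by move=> v u /nP[_ _ _ h] uV; exact: h.
exists V, n, p; split=> //.
apply/seteqP; split.
  apply: conv_sub; first exact: convex_conv.
  move=> u us; apply/(conv_ngonP VP) => v /nP[_ _ h _].
  by rewrite edgef_latt ler_int h.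
by apply: sub_conv => v /VE[].
Qed.

Lemma LDP_ngon Q : LDP_polygon Q -> exists V n p,
  [/\ ngon V n p, Q = conv V & {in V, forall v, primitive v}].
Proof.
move=> [[s ->] /conv_ngon[V [n [p [VP ->]]]] hprim].
exists V, n, p; split=> // v vV.
by have [w /latt_inj ->] := hprim _ (vertex_conv R VP vV).
Qed.

Lemma ngon_LDP V n p : ngon V n p -> {in V, forall v, primitive v} ->
  LDP_polygon (@conv R V).
Proof.
move=> VP Vprim; split; [by exists V|exact: ngon_interior VP|].
by move=> x; rewrite (verticesE R VP) => -[v vV <-]; exists v => //; exact: Vprim.
Qed.

End Polygon.

(** * Unimodular maps and fans *)

Lemma primitive_mul M v : unimodular M -> primitive v -> primitive (M *m v).
Proof.
move=> uM /primitiveP[w vw]; apply/primitiveP.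
case: uM => dM; first by exists (M *m w); rewrite det2_mul dM vw.
exists (M *m (- w)); rewrite det2_mul dM mulN1r -vw.
by rewrite /det2 !mxE; ring.
Qed.

Lemma unimodular_inv M : unimodular M ->
  exists N, [/\ unimodular N, N *m M = 1%:M, M *m N = 1%:M & \det N = \det M].
Proof.
move=> uM.
have dM : \det M * \det M = 1 by case: uM => ->.
have Mu : M \in unitmx by rewrite unitmxE; apply/unitrPr; exists (\det M).
have dN : \det (invmx M) = \det M.
  apply: (mulIf (_ : \det M != 0)); first by case: uM => ->.
  by rewrite -det_mulmx mulVmx // det1 dM.
exists (invmx M); split=> //; first by rewrite /unimodular dN.
  exact: mulVmx.
exact: mulmxV.
Qed.

(* Orientation-reversing matrices exchange the two ends of a cone. *)
Definition orient_mul M (q : 'cV[int]_2 * 'cV[int]_2) :=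
  if \det M == 1 then (M *m q.1, M *m q.2) else (M *m q.2, M *m q.1).

Lemma orient_mulK M N : N *m M = 1%:M -> \det N = \det M ->
  cancel (orient_mul M) (orient_mul N).
Proof.
move=> NM dN [a b]; rewrite /orient_mul dN.
by case: eqP => _; rewrite /= !mulmxA NM !mul1mx.
Qed.

Lemma det2_orient M q : unimodular M ->
  det2 (orient_mul M q).1 (orient_mul M q).2 = det2 q.1 q.2.
Proof.
by rewrite /orient_mul => -[] dM; rewrite dM /= det2_mul dM ?mul1r // det2C mulN1r opprK.
Qed.

Section Lin.
Variable R : realType.
Implicit Types (Q F : set 'cV[R]_2) (D : set (set 'cV[R]_2)).

Lemma latt_mul M v : latt R (M *m v) = map_mx intr M *m latt R v.
Proof. by rewrite /latt map_mxM. Qed.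

Lemma map_mxK M N : N *m M = 1%:M ->
  map_mx intr N *m map_mx intr M = 1%:M :> 'M[R]_2.
Proof. by move=> NM; rewrite -map_mxM NM map_mx1. Qed.

Lemma lin_imageK M N Q : N *m M = 1%:M -> lin_image N (lin_image M Q) = Q.
Proof.
move=> /map_mxK NM; apply/seteqP; split=> x.
  by move=> [_ [y Qy <-] <-]; rewrite mulmxA NM mul1mx.
move=> Qx; exists (map_mx intr M *m x); first by exists x.
by rewrite mulmxA NM mul1mx.
Qed.

Lemma lin_image1 : @lin_image R 1%:M = id.
Proof.
apply/funext => Q; apply/seteqP; split=> [_ [x Qx <-]|x Qx].
  by rewrite map_mx1 mul1mx.
by exists x => //; rewrite map_mx1 mul1mx.
Qed.

Lemma convex_preim M Q : @convex_set R 'cV[R]_2 Q ->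
  @convex_set R 'cV[R]_2 [set x | Q (map_mx intr M *m x)].
Proof.
move=> /convexP cQ; apply/convexP => x y a b Qx Qy a0 b0 ab /=.
by rewrite mulmxDr -!scalemxAr; exact: cQ.
Qed.

Lemma sub_lin_image_conv M s :
  lin_image M (@conv R s) `<=` conv [seq M *m v | v <- s].
Proof.
move=> _ [x cx <-]; move: x cx.
apply: (@conv_sub R s [set x | conv [seq M *m v | v <- s] (map_mx intr M *m x)]).
  exact/convex_preim/convex_conv.
by move=> u us; rewrite /= -latt_mul; apply: mem_conv; exact: map_f.
Qed.

Lemma lin_image_conv M s : unimodular M ->
  lin_image M (@conv R s) = conv [seq M *m v | v <- s].
Proof.
move=> /unimodular_inv[N [_ NM MN _]]; apply/seteqP; split.
  exact: sub_lin_image_conv.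
move=> x cx; exists (map_mx intr N *m x).
  have := @sub_lin_image_conv N [seq M *m v | v <- s] _ (ex_intro2 _ _ x cx erefl).
  by rewrite -map_comp (@eq_map _ _ _ id) ?map_id // => v /=; rewrite mulmxA NM mul1mx.
by rewrite mulmxA map_mxK // mul1mx.
Qed.

Lemma lin_image_conv2 M v w : unimodular M ->
  lin_image M (@conv R [:: v; w]) = conv [:: M *m v; M *m w].
Proof. exact: lin_image_conv. Qed.

Lemma lin_image_cone M F : lin_image M (cone_over F) = cone_over (lin_image M F).
Proof.
apply/seteqP; split=> [_ [_ [l [y [l0 Fy ->]]] <-]|_ [l [_ [l0 [y Fy <-] ->]]]].
  exists l, (map_mx intr M *m y); rewrite -scalemxAr; split=> //.
  by exists y.
by exists (l *: y); [exists l, y|rewrite -scalemxAr].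
Qed.

Lemma conv2C v w : @conv R [:: v; w] = conv [:: w; v].
Proof. by apply/seteqP; split; apply: sub_conv => z; rewrite !inE orbC. Qed.

Lemma conv_orient M q : unimodular M ->
  lin_image M (@conv R [:: q.1; q.2]) = conv [:: (orient_mul M q).1; (orient_mul M q).2].
Proof.
move=> uM; rewrite lin_image_conv2 // /orient_mul.
by case: ifP => _ //=; rewrite conv2C.
Qed.

Lemma proper_face_lin M Q F : unimodular M -> proper_face Q F ->
  proper_face (lin_image M Q) (lin_image M F).
Proof.
move=> /unimodular_inv[N [_ NM MN _]] [[x0 Fx0] [l [c [l0 lc FE]]]].
have lN x : l *m map_mx intr N *m (map_mx intr M *m x) = l *m x :> 'rV[R]_1.
  by rewrite mulmxA -(mulmxA l) map_mxK // mulmx1.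
split; first by exists (map_mx intr M *m x0); exists x0.
exists (l *m map_mx intr N), c; split.
- apply: contra_neq l0 => e.
  by rewrite -[l]mulmx1 -(map_mxK NM) mulmxA e mul0mx.
- by move=> _ [x Qx <-]; rewrite lN lc.
- apply/seteqP; split=> [_ [x + <-]|_ [[x Qx <-]]].
    by rewrite FE => -[Qx lx]; split; [exists x|rewrite lN].
  by rewrite lN => lx; exists x => //; rewrite FE.
Qed.

Lemma edge_lin M Q F : unimodular M -> edge Q F -> edge (lin_image M Q) (lin_image M F).
Proof.
move=> uM [pF [x [y [Fx Fy xy]]]]; split; first exact: proper_face_lin.
exists (map_mx intr M *m x), (map_mx intr M *m y); split; [by exists x|by exists y|].
have [N [_ NM MN _]] := unimodular_inv uM.
apply: contra_neq xy => e.
by rewrite -[x]mul1mx -[y]mul1mx -(map_mxK NM) -!mulmxA e.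
Qed.

(** Finiteness matters because [fset_set] takes a default value on infinite sets. *)
Lemma card_fset_bij (T : choiceType) (A B : set T) (f g : T -> T) : finite_set A ->
  cancel f g -> cancel g f -> (forall x, A x -> B (f x)) -> (forall x, B x -> A (g x)) ->
  #|` fset_set B| = #|` fset_set A|.
Proof.
move=> Afin fK gK AB BA.
have -> : B = f @` A.
  apply/seteqP; split=> [x Bx|_ [x Ax <-]]; last exact: AB.
  by exists (g x); [exact: BA|exact: gK].
by rewrite fset_set_image // card_imfset //; exact: can_inj fK.
Qed.

Lemma singular_points_lin M Q q : unimodular M -> singular_points Q q ->
  singular_points (lin_image M Q) (orient_mul M q).
Proof.
move=> uM [[eq d0] d]; split; last by rewrite det2_orient.
by split; [rewrite -conv_orient //; exact: edge_lin|rewrite det2_orient].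
Qed.

Lemma nb_singular_points_lin M Q : unimodular M -> finite_set (singular_points Q) ->
  nb_singular_points (lin_image M Q) = nb_singular_points Q.
Proof.
move=> uM Qfin; have [N [uN NM MN dN]] := unimodular_inv uM.
apply: (card_fset_bij (f := orient_mul M) (g := orient_mul N)) => //.
- exact: orient_mulK.
- exact: orient_mulK.
- by move=> q; exact: singular_points_lin.
- by move=> q /(singular_points_lin uN); rewrite (lin_imageK _ NM).
Qed.

(** Singular fixed points read off a bare set of cones; primitivity fixes the lengths of the
    generators, which a cone forgets. *)
Definition singular_cones D : set ('cV[int]_2 * 'cV[int]_2) :=
  [set q | [/\ primitive q.1, primitive q.2, 2 <= det2 q.1 q.2
             & D (cone_over (conv [:: q.1; q.2]))]].

Lemma singular_cones_lin M D q : unimodular M -> singular_cones D q ->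
  singular_cones (lin_image M @` D) (orient_mul M q).
Proof.
move=> uM [p1 p2 d Dq]; split; [| |by rewrite det2_orient|].
- by rewrite /orient_mul; case: ifP => _; exact: primitive_mul.
- by rewrite /orient_mul; case: ifP => _; exact: primitive_mul.
- by exists (cone_over (conv [:: q.1; q.2])); rewrite ?lin_image_cone ?conv_orient.
Qed.

Lemma card_singular_cones_lin M D : unimodular M -> finite_set (singular_cones D) ->
  #|` fset_set (singular_cones (lin_image M @` D))| = #|` fset_set (singular_cones D)|.
Proof.
move=> uM Dfin; have [N [uN NM MN dN]] := unimodular_inv uM.
apply: (card_fset_bij (f := orient_mul M) (g := orient_mul N)) => //.
- exact: orient_mulK.
- exact: orient_mulK.
- by move=> q; exact: singular_cones_lin.
- move=> q /(singular_cones_lin uN); rewrite image_comp.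
  rewrite (_ : (lin_image N \o lin_image M) @` D = D) //.
  by apply/seteqP; split=> [_ [x Dx <-]|x Dx]; [|exists x]; rewrite ?/= ?(lin_imageK _ NM).
Qed.

Lemma singular_pointsE_fan V n p : ngon V n p -> {in V, forall v, primitive v} ->
  singular_points (@conv R V) = singular_cones (fan_of (conv V)).
Proof.
move=> VP Vprim; rewrite (singular_pointsE R VP).
have Vn := ngon_next VP; apply/seteqP; split=> [_ [v + <-]|[a b] [/= pa pb d]].
  rewrite /= mem_filter => /andP[d vV]; split=> //=.
  - exact: Vprim.
  - exact/Vprim/Vn.
  - by apply/(fan_ofP VP); constructor 1; exists v.
have d0 : 0 < det2 a b by apply: lt_le_trans d.
move=> /(fan_ofP VP)[[v vV]|[v vV]|].
- move=> /cone2_inj-/(_ pa pb (Vprim _ vV) (Vprim _ (Vn _ vV)) d0 (ngon_det VP vV)).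
  by case=> ea eb; exists v; [rewrite mem_filter vV eb ea d|rewrite eb ea].
- by move/(cone2_neq_flat d0): (@cone1_flat R v).
- move/(cone2_neq_flat d0); case => x y -> ->.
  by rewrite /rdet; ring.
Qed.

(** The cone removed and the two plane cones inserted have determinant 1, and the third insertion is
    a ray, so none of them is counted. *)
Lemma singular_cones_blowup D v w : det2 v w = 1 ->
  singular_cones (blowup_fan D v w) = singular_cones D.
Proof.
move=> d1.
have dl : det2 v (v + w) = 1 by rewrite -d1 /det2 !mxE; ring.
have dr : det2 (v + w) w = 1 by rewrite -d1 /det2 !mxE; ring.
have vP : primitive v by apply/primitiveP; exists w.
have vwP : primitive (v + w) by apply/primitiveP; exists w.
have wP : primitive w.
  by apply/primitiveP; exists (- v); rewrite -d1 /det2 !mxE; ring.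
have excl (a b v' w' : 'cV[int]_2) : primitive a -> primitive b -> 2 <= det2 a b ->
    primitive v' -> primitive w' -> det2 v' w' = 1 ->
    cone_over (@conv R [:: a; b]) = cone_over (conv [:: v'; w']) -> False.
  move=> pa pb d pv pw d' /cone2_inj-/(_ pa pb pv pw)[||ea eb].
  - exact: lt_le_trans d.
  - by rewrite d'.
  - by move: d; rewrite -ea -eb d'.
apply/seteqP; split=> -[a b] [/= pa pb d].
  move=> [[Dab _]|]; first by split.
  move=> [[|]|]; [by move/excl; case|by move/excl; case|].
  move/(@cone2_neq_flat R); case; first exact: lt_le_trans d.
  exact: cone1_flat.
move=> Dab; split=> //; left; split=> //.
by move/excl; apply.
Qed.

End Lin.

(** * Smooth edges *)

(** The determinant in the lattice basis (v, w), where [u] has the coordinates [det2 u w] and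
    [det2 v u]; the conflicts between smooth edges are computed in these coordinates. *)
Lemma det2_coord v w u z : det2 v w = 1 ->
  det2 u z = det2 u w * det2 v z - det2 v u * det2 z w.
Proof. by move=> d; rewrite -[LHS]mulr1 -d /det2; ring. Qed.

(** Such a vector is a multiple of (1, -1) in the basis, and primitivity makes the factor a unit. *)
Lemma primitive_antidiag v w u : det2 v w = 1 -> primitive u ->
  det2 u w + det2 v u = 0 -> `|det2 u w| = 1 /\ `|det2 v u| = 1.
Proof.
move=> d /primitiveP[z uz] e.
have : (det2 u w %| 1)%Z.
  apply/dvdzP; exists (det2 v z + det2 z w).
  transitivity (det2 u z); first by rewrite uz.
  rewrite (det2_coord u z d).
  have -> : det2 v u = - det2 u w by lia.
  by ring.
by rewrite dvdz1; lia.
Qed.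

(** The point (x, y) forces b < a, because y < -x, and the point (xd, yd) forces a < b, because xd <
    -yd. *)
Lemma isolated_both_int (x y xd yd a b : int) : 0 <= a -> 0 <= b ->
  (a != 0) || (b != 0) -> x <= -2 -> x + y < 0 -> yd <= -2 -> xd + yd < 0 ->
  0 <= b * x + a * y -> 0 <= b * xd + a * yd -> False.
Proof.
move=> a0 b0 ab x2 xy y2 xyd h1 h2.
have [aE|an] := eqVneq a 0; first by nia.
have [bE|bn] := eqVneq b 0; first by nia.
have ab1 : b < a by nia.
nia.
Qed.

(** Now (x, y) is an end of the second edge, so the functional is 1 there. The point (xd, yd) still
    gives a < b, and b (-x) = 1 + a y with y < -x then contradicts x <= -2. *)
Lemma isolated_end_int (x y xd yd a b : int) : 0 <= a -> 0 <= b ->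
  x <= -2 -> x + y < 0 -> yd <= -2 -> xd + yd < 0 ->
  - (b * x) - a * y = 1 -> 0 <= b * xd + a * yd -> False.
Proof.
move=> a0 b0 x2 xy y2 xyd h1 h2.
have [bE|bn] := eqVneq b 0.
  move: h1 h2; rewrite bE !mul0r => h1 h2.
  have [aE|an] := eqVneq a 0; first by move: h1; rewrite aE mul0r; lia.
  nia.
have bx : 2 <= - (b * x) by nia.
have [aE|an] := eqVneq a 0; first by move: h1; rewrite aE mul0r; lia.
have [y0|y0] := lerP y 0; first by nia.
have xd0 : 0 < xd by nia.
have ab1 : a + 1 <= b by nia.
nia.
Qed.

(** The first bound comes from a vertex at (-1, p) and yields b <= a, while (xd, yd) demands a <
    b. *)
Lemma third_edge_int (xd yd a b p : int) : 0 <= a -> 0 <= b ->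
  (a != 0) || (b != 0) -> b <= a * p -> p <= 1 -> yd <= -2 -> xd + yd < 0 ->
  0 <= b * xd + a * yd -> False.
Proof.
move=> a0 b0 ab h p1 y2 xyd h2.
have a1 : 0 < a by nia.
have [p0|p0] := lerP p 0; first by nia.
have bE : b <= a by nia.
have xd0 : 0 < xd by nia.
nia.
Qed.

(** The third and fourth vertices are (-1, p) and (q, r). The determinant 1 and q + r <= 0 give q (1
    - p) <= 1, so p = 0 or q = 0, with r = -1 either way; the vertex (xd, yd) excludes both
    cases. *)
Lemma chain_int (xd yd p q r : int) : p <= 0 -> 0 <= q -> - r - p * q = 1 ->
  q + r <= 0 -> yd <= -2 -> xd + yd < 0 ->
  xd * r - yd * q - yd - p * xd <= 0 -> xd * p + yd - xd <= 0 -> False.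
Proof.
move=> p0 q0 rE qr y2 xyd h1 h2.
have [pE|pn] := eqVneq p 0; first by nia.
have qE : q = 0 by nia.
have r1 : r = -1 by nia.
have xd0 : 0 <= xd by nia.
nia.
Qed.

Section Combinatorics.
Variables (V : seq 'cV[int]_2) (n p : 'cV[int]_2 -> 'cV[int]_2).
Hypothesis VP : ngon V n p.
Hypothesis Vprim : {in V, forall v, primitive v}.
Let Vn := ngon_next VP.
Let Vp := ngon_prev VP.
Let nK := ngon_nextK VP.
Let pK := ngon_prevK VP.
Local Notation smooth v := (det2 v (n v) == 1).

Lemma not_smooth v : v \in V -> (~~ smooth v) = (2 <= det2 v (n v)).
Proof. by move=> /(ngon_det VP); lia. Qed.

Lemma smooth_supp v u : v \in V -> smooth v -> u \in V -> u != v -> u != n v ->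
  det2 u (n v) + det2 v u <= 0.
Proof.
by move=> vV /eqP d uV uv un; have := ngon_supp VP vV uV uv un; rewrite d; lia.
Qed.

Lemma smooth_supp_lt v u : v \in V -> smooth v -> u \in V -> u != v -> u != n v ->
  (2 <= `|det2 u (n v)|) || (2 <= `|det2 v u|) -> det2 u (n v) + det2 v u < 0.
Proof.
move=> vV sv uV uv un h; rewrite lt_neqAle smooth_supp // andbT.
apply/eqP => e; have := primitive_antidiag (eqP sv) (Vprim uV) e.
by move: h; lia.
Qed.

Lemma eq_next v w : v \in V -> w \in V -> (n v == w) = (v == p w).
Proof.
by move=> vV wV; apply/eqP/eqP => [<-|->]; [rewrite nK|rewrite pK].
Qed.

Lemma neq_next v w : v \in V -> w \in V -> v != w -> n v != n w.
Proof. by move=> vV wV; apply: contra_neq; exact: (next_inj VP). Qed.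

Lemma prev_coord v : v \in V -> smooth v -> ~~ smooth (p v) ->
  det2 v (p v) <= -2 /\ det2 (p v) (n v) + det2 v (p v) < 0.
Proof.
move=> vV sv; rewrite not_smooth ?Vp // pK // => h.
have y2 : det2 v (p v) <= -2 by rewrite det2C; lia.
split=> //; apply: smooth_supp_lt => //; first exact: Vp.
- exact: prev_neq VP _ vV.
- by rewrite eq_sym (next_neq_prev VP).
- by apply/orP; right; lia.
Qed.

(** In the basis (v, n v) the functional of the edge at [w] is -(b x + a y), with a and b the two
    coordinate differences. Being nonpositive at [v] and [n v] gives the signs of b and a, and it is
    not zero because its value at [w] is 1. *)
Lemma smooth_edge_coord v w : v \in V -> w \in V -> smooth v -> smooth w ->
  ~~ smooth (p v) -> w != v -> w != n v ->
  [/\ 0 <= det2 (n w) (n v) - det2 w (n v), 0 <= det2 v w - det2 v (n w),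
   (det2 (n w) (n v) - det2 w (n v) != 0) || (det2 v w - det2 v (n w) != 0)
  & forall u, u \in V -> u != w -> u != n w ->
    0 <= (det2 v w - det2 v (n w)) * det2 u (n v)
       + (det2 (n w) (n v) - det2 w (n v)) * det2 v u].
Proof.
move=> vV wV sv sw spv wv wn.
have nwv : n w != v.
  by rewrite eq_next //; apply: contraNneq spv => <-.
have nwn : n w != n v by apply: neq_next.
have coord u z := det2_coord u z (eqP sv).
have sup u : u \in V -> u != w -> u != n w ->
    0 <= (det2 v w - det2 v (n w)) * det2 u (n v)
       + (det2 (n w) (n v) - det2 w (n v)) * det2 v u.
  move=> uV uw unw; have := smooth_supp wV sw uV uw unw.
  rewrite (coord u (n w)) (coord w u) -oppr_le0 => h; apply: le_trans h.
  by rewrite le_eqVlt; apply/orP; left; apply/eqP; ring.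
have supv := sup v vV; have supn := sup _ (Vn vV).
rewrite det2vv (eqP sv) mulr1 mulr0 addr0 in supv.
rewrite det2vv (eqP sv) mulr1 mulr0 add0r in supn.
have := supv; rewrite ![v == _]eq_sym => /(_ wv nwv) h1.
have := supn; rewrite ![n v == _]eq_sym => /(_ wn nwn) h2.
split=> //; rewrite -negb_and !subr_eq0; apply/negP => /andP[/eqP e1 /eqP e2].
have := coord w (n w); rewrite (eqP sw) e1 -e2 mulrC subrr => /eqP.
by rewrite oner_eq0.
Qed.

(** The functional of the edge at [w] is tested on [n (n v)] and [p v]. If neither is an end of that
    edge, [isolated_both_int] applies; if exactly one is, [isolated_end_int] does, possibly with the
    coordinates exchanged. *)
Lemma smooth_isolated v w : v \in V -> w \in V -> smooth v -> smooth w -> w != v ->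
  ~~ smooth (p v) -> ~~ smooth (n v) -> w = n (n v) /\ n w = p v.
Proof.
move=> vV wV sv sw wv spv snv.
have wn : w != n v by apply: contraNneq snv => <-.
have [a0 b0 ab sup] := smooth_edge_coord vV wV sv sw spv wv wn.
have [y2 xyd] := prev_coord vV sv spv.
have n2V : n (n v) \in V by rewrite !Vn.
have x2 : det2 (n (n v)) (n v) <= -2.
  by move: snv; rewrite not_smooth ?Vn // [det2 (n (n v)) _]det2C; lia.
have xy : det2 (n (n v)) (n v) + det2 v (n (n v)) < 0.
  apply: smooth_supp_lt => //; first exact: next2_neq VP _ vV.
    exact: next_neq VP _ (Vn vV).
  by apply/orP; left; lia.
have wp : w != p v by apply: contraNneq spv => <-.
have n2w : n (n v) != n w by apply: neq_next; rewrite ?Vn // eq_sym.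
have coord := det2_coord w (n w) (eqP sv); rewrite (eqP sw) in coord.
have pw : p v != w by rewrite eq_sym.
have [e1|ne1] := eqVneq w (n (n v)); have [e2|ne2] := eqVneq (n w) (p v) => //.
- exfalso; apply: (isolated_end_int a0 b0 x2 xy y2 xyd).
    by rewrite -e1 coord; ring.
  by apply: sup; rewrite ?Vp // eq_sym.
- exfalso; rewrite addrC in xyd; rewrite addrC in xy.
  apply: (isolated_end_int b0 a0 y2 xyd x2 xy).
    by rewrite -e2 coord; ring.
  by rewrite addrC; apply: sup => //; rewrite eq_sym.
- exfalso; apply: (isolated_both_int a0 b0 ab x2 xy y2 xyd).
    by apply: sup => //; rewrite eq_sym.
  by apply: sup; rewrite ?Vp // eq_sym.
Qed.

(** Smoothness of the edge at [n v] places [n (n v)] at (-1, y) with y <= 1, the situation of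
    [third_edge_int]. *)
Lemma smooth_third v w : v \in V -> w \in V -> smooth v -> smooth (n v) ->
  ~~ smooth (p v) -> smooth w -> w != v -> w != n v -> w != n (n v) -> n w = p v.
Proof.
move=> vV wV sv snv spv sw wv wn wnn; apply/eqP/negPn/negP => nwp.
have [a0 b0 ab sup] := smooth_edge_coord vV wV sv sw spv wv wn.
have [y2 xyd] := prev_coord vV sv spv.
have n2V : n (n v) \in V by rewrite !Vn.
have x1 : det2 (n (n v)) (n v) = -1 by rewrite det2C (eqP snv).
have xy := smooth_supp vV sv n2V (next2_neq VP vV) (next_neq VP (Vn vV)).
have n2w : n (n v) != n w by apply: neq_next; rewrite ?Vn // eq_sym.
have wp : w != p v by apply: contraNneq spv => <-.
have h1 := sup _ n2V; rewrite ![n (n v) == _]eq_sym wnn in h1.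
have h2 := sup _ (Vp vV); rewrite ![p v == _]eq_sym wp nwp in h2.
apply: (third_edge_int a0 b0 ab (p := det2 v (n (n v))) _ _ y2 xyd).
- by have := h1 isT; rewrite eq_sym n2w x1 => /(_ isT); clear; lia.
- by move: xy; rewrite x1; clear; lia.
- exact: h2.
Qed.

(** In the basis (v, n v) the first alternative means that [n (n v)] is (-1, 1), the second that
    [n (n (n v))] has first coordinate -1. If both fail, the support inequalities of the three
    smooth edges form the system of [chain_int]. *)
Lemma smooth_chain v : v \in V -> smooth v -> smooth (n v) -> smooth (n (n v)) ->
  ~~ smooth (p v) -> n (n (n v)) != v -> n (n (n v)) != p v ->
  n v = v + n (n v) \/ n (n v) = n v + n (n (n v)).
Proof.
move=> vV sv snv snnv spv n3v n3p.
have V2 := Vn vV; have V3 := Vn V2; have V4 := Vn V3.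
have coord u z := det2_coord u z (eqP sv).
have [y2 xyd] := prev_coord vV sv spv.
have x3 : det2 (n (n v)) (n v) = -1 by rewrite det2C (eqP snv).
have h3 := smooth_supp vV sv V3 (next2_neq VP vV) (next_neq VP V2).
have h4 := smooth_supp vV sv V4 n3v (next2_neq VP V2).
have k4 := smooth_supp V2 snv V4 (next2_neq VP V2) (next_neq VP V3).
have p1 := next_neq_prev VP vV; have p0 := prev_neq VP vV.
have p2 : p v != n (n v).
  by apply: contraNneq n3v => <-; rewrite pK.
have kd := smooth_supp V2 snv (Vp vV) _ p2; rewrite eq_sym p1 in kd.
have {kd} kd := kd isT.
have ld := smooth_supp V3 snnv (Vp vV) p2; rewrite eq_sym n3p in ld.
have {ld} ld := ld isT.
have e34 := coord (n (n v)) (n (n (n v))); rewrite (eqP snnv) x3 in e34.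
rewrite (coord _ (n (n v))) [det2 (n v) _]coord (eqP sv) x3 det2vv in k4.
rewrite (coord _ (n (n v))) [det2 (n v) _]coord (eqP sv) x3 det2vv in kd.
rewrite (coord (p v)) (coord (n (n v)) (p v)) x3 in ld.
have dn0 : det2 v (n v) != 0 by rewrite (eqP sv).
move: y2 xyd h3 h4 k4 kd ld e34.
set xd := det2 (p v) (n v); set yd := det2 v (p v).
have [y31|y31] := eqVneq (det2 v (n (n v))) 1.
  move=> *; left; apply: (det2_inj dn0).
    by rewrite (eqP sv) -y31 /det2 !mxE; ring.
  have -> : det2 (v + n (n v)) (n v) = det2 v (n v) + det2 (n (n v)) (n v).
    by rewrite /det2 !mxE; ring.
  by rewrite (eqP sv) x3 det2vv.
have [x41|x41] := eqVneq (det2 (n (n (n v))) (n v)) (-1).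
  move=> _ _ _ _ _ _ _ e34; right; apply: (det2_inj dn0).
    have -> : det2 v (n v + n (n (n v))) = det2 v (n v) + det2 v (n (n (n v))).
      by rewrite /det2 !mxE; ring.
    by move: e34; rewrite x41 (eqP sv); clear; lia.
  have -> : det2 (n v + n (n (n v))) (n v) = det2 (n (n (n v))) (n v).
    by rewrite /det2 !mxE; ring.
  by rewrite x3 x41.
move: y31 x41; set y3 := det2 v (n (n v)); set q := det2 _ (n v); set r := det2 v _.
move=> y31 x41 y2 xyd h3 h4 k4 kd ld e34; exfalso.
rewrite x3 in h3; clearbody xd yd y3 q r.
by apply: (@chain_int xd yd y3 q r) => //; clear -y31 x41 h3 h4 k4 kd ld e34; lia.
Qed.

End Combinatorics.

(** * Pentagons in normal form *)

Lemma gcdz1_mul q c : gcdz q (q * c) = 1 -> `|q| = 1.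
Proof.
have [a [b e]] := Bezoutz q (q * c); move=> g; rewrite g in e.
have : (q %| 1)%Z.
  by apply/dvdzP; exists (a + b * c); transitivity (a * q + b * (q * c)); [by rewrite e|ring].
by rewrite dvdz1; lia.
Qed.

(** Each of these bounds gains one unit from primitivity: in the boundary case one coordinate of a
    vertex divides the other, so it is 1 in absolute value, against a determinant of at least 2. *)
Lemma pentagon_normal_int (p q r s t : int) : p <= 1 -> 2 <= - r - p * q ->
  2 <= q * t - r * s -> t <= -2 -> s + t <= 0 -> q + r <= 0 ->
  p * q + r - q <= 0 -> - t - p * s < - r - p * q + (q * t - r * s) ->
  t - r < q * t - r * s -> gcdz q r = 1 -> gcdz s t = 1 ->
  [/\ r <= -1, r <= q - p * q - 1 & t <= - s - 1].
Proof.
move=> p1 d1 d2 t2 st qr k4 l4 l5 gqr gst.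
have r0 : r <= 0.
  rewrite leNgt; apply/negP => r1; have pE : p = 1 by nia.
  by subst p; lia.
have r1 : r <= -1.
  have [rE|] := eqVneq r 0; last by lia.
  have q0 : q < 0 by nia.
  have pE : p = 1 by nia.
  have q1 : `|q| = 1 by apply: (@gcdz1_mul q 0); rewrite mulr0 -rE.
  by subst p r; lia.
split=> //.
  have [e|] := eqVneq (p * q + r - q) 0; last by lia.
  have rE : r = q * (1 - p) by lia.
  by have := @gcdz1_mul q (1 - p); rewrite -rE => /(_ gqr); lia.
have [e|] := eqVneq (s + t) 0; last by lia.
have tE : t = s * (-1) by lia.
by have := @gcdz1_mul s (-1); rewrite -tE => /(_ gst); lia.
Qed.

(** The hypotheses contain convexity at each corner of the pentagon; the conclusions put each vertex
    below its opposite edge. Products of two hypotheses supply the nonlinear facts, and [prod_gt0]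
    cancels a positive factor. *)
Lemma pentagon_opposite_int (p q r s t : int) : p <= 1 -> r <= -1 ->
  r <= - p * q - 2 -> r <= q - p * q - 1 ->
  r <= - p * q + q * t - r * s + p * s + t - 1 ->
  t <= -2 -> t <= - s - 1 -> t <= q * t - r * s + r - 1 -> 2 <= q * t - r * s ->
  [/\ q + r < 1, p * s + t - s < 1, r - p < - r - p * q,
      q - s < q * t - r * s & - p + s * p + t < - t].
Proof.
move=> p1 r1 d1 k4 l4 t2 st l5 d2.
have prod_gt0 (a b : int) : 0 < a -> 0 < a * b -> 0 < b by move=> a0; rewrite pmulr_rgt0.
have d1' : 2 <= - r - p * q by lia.
have Nr : 0 < - r by lia.
have D2 : 0 < q * t - r * s by lia.
have D1 : 0 < - r - p * q by lia.
have D3 : 0 < - t by lia.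
split.
- rewrite ltNge; apply/negP => q1.
  have h1 : 0 <= - r * (- s - t - 1) by apply: mulr_ge0; lia.
  have h2 : 0 <= - t * (q + r - 1) by apply: mulr_ge0; lia.
  lia.
- have [s0|s0] := lerP 0 s.
    have : 0 <= (1 - p) * s by apply: mulr_ge0; lia.
    lia.
  have rs : 0 < - r * - s by apply: mulr_gt0; lia.
  have q0 : q < 0.
    rewrite ltNge; apply/negP => q0.
    have : 0 <= q * - t by apply: mulr_ge0; lia.
    lia.
  have h1 : 0 <= - s * (q * (1 - p) - 1 - r) by apply: mulr_ge0; lia.
  rewrite ltNge; apply/negP => h.
  have : 0 <= - q * (t + s * (p - 1) - 1) by apply: mulr_ge0; lia.
  lia.
- have h1 : 0 < - r * (- r - p * q - (- (q * t - r * s) - t - p * s)).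
    by apply: mulr_gt0 => //; lia.
  have h2 : 0 < (- r - p * q) * (q * t - r * s - (t - r)) by apply: mulr_gt0 => //; lia.
  rewrite -subr_gt0; apply: (prod_gt0 (q * t - r * s)) => //; lia.
- rewrite -subr_gt0; have [s0|s0] := lerP s 0; last first.
    have h1 : 0 < s * (q * t - r * s - (t - r)) by apply: mulr_gt0 => //; lia.
    have h2 : 0 <= (q * t - r * s) * (- t - 1 - s) by apply: mulr_ge0; lia.
    apply: (prod_gt0 (- t)) => //; lia.
  have rs : 0 <= - r * - s by apply: mulr_ge0; lia.
  have q0 : q < 0.
    rewrite ltNge; apply/negP => q0.
    have : 0 <= q * - t by apply: mulr_ge0; lia.
    lia.
  have h1 : 0 < - q * (q * t - r * s - (- t - p * s - (- r - p * q))).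
    by apply: mulr_gt0; lia.
  have h2 : 0 <= (q * t - r * s) * (- r - p * q - 1 + q) by apply: mulr_ge0; lia.
  apply: (prod_gt0 (- r - p * q)) => //; lia.
- have [p0|p0] := ltrP p 0; last first.
    have [pE|pE] : p = 0 \/ p = 1 by lia.
      by subst p; lia.
    by subst p; lia.
  (* [E] is the determinant of the third and the fifth vertex. *)
  pose E := - t - p * s.
  have E0 : 0 < E.
    apply: (prod_gt0 (- r)) => //.
    have h1 : 0 < (- r - p * q) * - t by apply: mulr_gt0; lia.
    have h2 : 0 < (q * t - r * s) * - p by apply: mulr_gt0; lia.
    rewrite /E; lia.
  have h1 : 0 < E * (- t - (- r - (q * t - r * s))) by apply: mulr_gt0 => //; lia.
  have h2 : 0 < - t * (- r - p * q + (q * t - r * s) - E).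
    by apply: mulr_gt0 => //; rewrite /E; lia.
  rewrite -subr_gt0; apply: (prod_gt0 (q * t - r * s)) => //.
  by move: h1 h2; rewrite /E; lia.
Qed.

(** * Counting smooth edges *)

Section Counting.
Variables (V : seq 'cV[int]_2) (n p : 'cV[int]_2 -> 'cV[int]_2).
Hypothesis VP : ngon V n p.
Hypothesis Vprim : {in V, forall v, primitive v}.
Let Vn := ngon_next VP.
Let Vp := ngon_prev VP.
Let nK := ngon_nextK VP.
Let pK := ngon_prevK VP.
Let Vu := ngon_uniq VP.
Local Notation smooth := (fun v => det2 v (n v) == 1).
Local Notation singular := (fun v => 2 <= det2 v (n v)).

(** The injective map [n] is a bijection of a finite set closed under it, so the set is closed under
    [p] as well and [ngon_orbit] applies. *)
Lemma ngon_closed (R : realType) (W : seq 'cV[int]_2) : W != [::] -> {subset W <= V} ->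
  {in W, forall v, n v \in W} -> {subset V <= W}.
Proof.
move=> W0 WV Wn; apply: (ngon_orbit R VP) => // u uW.
have Wu := undup_uniq W.
have nWu : uniq [seq n v | v <- undup W].
  rewrite map_inj_in_uniq // => v w; rewrite !mem_undup => vW wW.
  by apply: (next_inj VP); exact: WV.
have sub : {subset [seq n v | v <- undup W] <= undup W}.
  by move=> _ /mapP[v + ->]; rewrite !mem_undup; exact: Wn.
have [_ eqW] := uniq_min_size nWu sub (eq_leq (esym (size_map n _))).
have : u \in undup W by rewrite mem_undup.
rewrite -eqW => /mapP[v + ->]; rewrite mem_undup => vW.
by rewrite nK // WV.
Qed.

Lemma ngon_closed_size (R : realType) (W : seq 'cV[int]_2) : W != [::] ->
  {subset W <= V} -> {in W, forall v, n v \in W} -> (size V <= size W)%N.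
Proof. by move=> W0 WV Wn; apply: uniq_leq_size => //; exact: (ngon_closed R). Qed.

Lemma count_le_size (P : pred 'cV[int]_2) (W : seq 'cV[int]_2) :
  (forall v, v \in V -> P v -> v \in W) -> (count P V <= size W)%N.
Proof.
move=> h; rewrite -size_filter; apply: uniq_leq_size; first exact: filter_uniq Vu.
by move=> v; rewrite mem_filter => /andP[Pv vV]; exact: h.
Qed.

Lemma size_le_count (P : pred 'cV[int]_2) (W : seq 'cV[int]_2) : uniq W ->
  (forall v, v \in W -> v \in V /\ P v) -> (size W <= count P V)%N.
Proof.
move=> Wu h; rewrite -size_filter; apply: uniq_leq_size => // v /h[vV Pv].
by rewrite mem_filter Pv.
Qed.

Lemma count_smooth : (count smooth V + count singular V)%N = size V.
Proof.
rewrite -(count_predC smooth V); congr (_ + _)%N.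
by apply: eq_in_count => v vV /=; rewrite (not_smooth VP).
Qed.

Lemma iter_next_mem k v : v \in V -> iter k n v \in V.
Proof. by move=> vV; elim: k => //= k; exact: Vn. Qed.

Lemma iter_next_inj i j v : v \in V -> iter (i + j) n v = iter i n v -> iter j n v = v.
Proof.
move=> vV; elim: i => //= i IH e; apply: IH.
by apply: (next_inj VP) e; exact: iter_next_mem.
Qed.

(** An early return would give a closed set with fewer vertices than [V]. *)
Lemma iter_next_neq (R : realType) k v : v \in V -> (0 < k < size V)%N ->
  iter k n v != v.
Proof.
move=> vV /andP[k0 kV]; apply/eqP => e.
have : (size V <= size (traject n v k))%N.
  apply: (ngon_closed_size R).
  - by case: k k0 {kV e}.
  - by move=> _ /trajectP[i _ ->]; exact: iter_next_mem.
  - move=> _ /trajectP[i ik ->]; rewrite -iterS; have [ik'|] := ltnP i.+1 k.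
      by apply/trajectP; exists i.+1.
    rewrite leq_eqVlt ltnNge ik orbF => /eqP <-; rewrite e.
    by apply/trajectP; exists 0%N.
by rewrite size_traject leqNgt kV.
Qed.

Lemma traject_next_uniq (R : realType) k v : v \in V -> (k <= size V)%N ->
  uniq (traject n v k).
Proof.
case: k => // k vV kV; rewrite looping_uniq; apply/negP => /trajectP[i ik e].
have := @iter_next_inj i (k - i) v vV; rewrite subnKC ?(ltnW ik) // => /(_ e).
by apply/eqP; apply: (iter_next_neq R) => //; lia.
Qed.

Lemma traject_next_perm (R : realType) v : v \in V -> traject n v (size V) =i V.
Proof.
move=> vV; have Tu := traject_next_uniq R vV (leqnn _).
apply: (uniq_min_size Tu _ _).2; last by rewrite size_traject.
by move=> _ /trajectP[i _ ->]; exact: iter_next_mem.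
Qed.

Lemma iter_next_size (R : realType) v : v \in V -> iter (size V) n v = v.
Proof.
move=> vV; have : iter (size V) n v \in traject n v (size V).
  by rewrite (traject_next_perm R) // iter_next_mem.
move=> /trajectP[[//|i] ik e].
have := @iter_next_inj i.+1 (size V - i.+1) v vV; rewrite subnKC ?(ltnW ik) // => /(_ e).
by move/eqP; rewrite (negPf (iter_next_neq R vV _)) //; lia.
Qed.

(* Going counterclockwise, a run of smooth edges that follows a singular edge
   contains every smooth edge. *)
Lemma three_singular (R : realType) : (5 <= size V)%N -> count singular V = 3%N ->
  exists v, [/\ v \in V, smooth v, smooth (n v), ~~ smooth (p v) &
    (size V = 5%N /\ forall w, w \in V -> smooth w -> w \in [:: v; n v]) \/ (size V = 6%N /\ smooth (n (n v)))].
Proof.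
move=> V5 V3; have cS := count_smooth; rewrite V3 in cS.
(* With a singular successor edge, [smooth_isolated] would close the polygon after four steps. *)
have iso v w : v \in V -> w \in V -> smooth v -> smooth w -> w != v ->
    ~~ smooth (p v) -> smooth (n v).
  move=> vV wV sv sw wv spv; apply/negPn/negP => snv.
  have [e1 e2] := smooth_isolated VP Vprim vV wV sv sw wv spv snv.
  have : iter 4 n v = v by rewrite /= -e1 e2 pK.
  by apply/eqP; apply: (iter_next_neq R) => //; lia.
(* Some run of smooth edges has a beginning: otherwise the three singular edges would be closed
   under [n] and exhaust [V]. *)
have [v0 [v0V sv0 spv0]] : exists v, [/\ v \in V, smooth v & ~~ smooth (p v)].
  apply/not_existsP => h.
  have : (size V <= size [seq v <- V | singular v])%N.
    apply: (ngon_closed_size R).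
    - by rewrite -size_eq0 size_filter V3.
    - by move=> v; rewrite mem_filter => /andP[].
    - move=> v; rewrite !mem_filter => /andP[sv vV]; rewrite Vn // andbT.
      rewrite -(not_smooth VP) ?Vn //; apply/negP => snv.
      by apply: (h (n v)); split; rewrite ?Vn // nK // (not_smooth VP).
  by rewrite size_filter V3; lia.
have [w0 [w0V sw0 w0v0]] : exists w, [/\ w \in V, smooth w & w != v0].
  apply/not_existsP => h.
  have := @count_le_size smooth [:: v0] => /=; rewrite -ltnS => k.
  suff : (count smooth V < 2)%N by lia.
  apply: k => v vV sv; rewrite inE; apply/negPn/negP => vv0.
  by apply: (h v).
exists v0; have snv := iso _ _ v0V w0V sv0 sw0 w0v0 spv0; split=> //.
have V2 := Vn v0V; have V2' := Vn V2.
have u3 : uniq [:: v0; n v0; n (n v0)].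
  by apply: (@traject_next_uniq R 3 v0 v0V); lia.
have third w : w \in V -> smooth w -> [\/ w = v0, w = n v0, w = n (n v0) | n w = p v0].
  move=> wV sw; have [->|wv] := eqVneq w v0; first by constructor 1.
  have [->|wn] := eqVneq w (n v0); first by constructor 2.
  have [->|wnn] := eqVneq w (n (n v0)); first by constructor 3.
  by constructor 4; apply: (smooth_third VP Vprim v0V wV).
(* What remains of [third] is a smooth edge ending at [p v0]. Its predecessor edge is smooth by
   [iso]; [third] for that edge makes [w] one of the listed vertices, or closes a pentagon with
   three smooth and three singular edges, or makes the edge at [p v0] smooth. *)
have run w : w \in V -> smooth w -> w \in [:: v0; n v0; n (n v0)].
  move=> wV sw; rewrite !inE; apply/negPn/negP => /norP[wv /norP[wn wnn]].
  have nw : n w = p v0 by case: (third w wV sw) => // e; move: wv wn wnn; rewrite e eqxx.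
  have pw : p w \in V by exact: Vp.
  have spw : smooth (p w).
    apply/negPn/negP => spw; have := iso _ _ wV v0V sw sv0.
    by rewrite eq_sym wv nw (negPf spv0) => /(_ isT spw).
  have [e|e|e|e] := third _ pw spw.
  - by move: wn; rewrite -e pK // eqxx.
  - by move: wnn; rewrite -e pK // eqxx.
  - have V5' : iter 5 n v0 = v0 by rewrite /= -e pK // nw pK.
    have V5'' : size V = 5%N.
      apply/eqP; rewrite eqn_leq V5 andbT leqNgt; apply/negP => V6.
      by move: V5'; apply/eqP; apply: (iter_next_neq R).
    have : (3 <= count smooth V)%N.
      apply: (@size_le_count smooth [:: v0; n v0; n (n v0)]) => //.
      by move=> u; rewrite !inE => /or3P[]/eqP->; split=> //; rewrite -e.
    by clear -cS V5''; lia.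
  - by move: spv0; rewrite -e pK // sw.
have c3 : (count smooth V <= 3)%N := @count_le_size smooth [:: v0; n v0; n (n v0)] run.
have [sn|sn] := boolP (smooth (n (n v0))).
  have : (3 <= count smooth V)%N.
    apply: (@size_le_count smooth [:: v0; n v0; n (n v0)]) => //.
    by move=> u; rewrite !inE => /or3P[]/eqP->; split.
  by right; split=> //; lia.
have run2 w : w \in V -> smooth w -> w \in [:: v0; n v0].
  move=> wV sw; have := run w wV sw; rewrite !inE orbA => /orP[//|/eqP e].
  by move: sn; rewrite -e sw.
left; split=> //.
have : (count smooth V <= 2)%N := @count_le_size smooth [:: v0; n v0] run2.
lia.
Qed.

End Counting.

(** * Removing a vertex that is the sum of its neighbours *)

Section Blowdown.
Variables (R : realType) (V : seq 'cV[int]_2) (n p : 'cV[int]_2 -> 'cV[int]_2).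
Hypothesis VP : ngon V n p.
Hypothesis Vprim : {in V, forall v, primitive v}.
Let Vn := ngon_next VP.
Let Vp := ngon_prev VP.
Let nK := ngon_nextK VP.
Let pK := ngon_prevK VP.
Variable b : 'cV[int]_2.
Hypothesis bV : b \in V.
Hypothesis bE : b = p b + n b.
Hypothesis bdet : det2 (p b) b = 1.

Let V' := rem b V.
Let n' u := if u == p b then n b else n u.
Let p' u := if u == n b then p b else p u.

Let mem_V' u : (u \in V') = (u != b) && (u \in V).
Proof. by rewrite mem_rem_uniq ?(ngon_uniq VP). Qed.

Let pbb : p b != b := prev_neq VP bV.
Let nbb : n b != b := next_neq VP bV.

Let det_pn : det2 (p b) (n b) = 1.
Proof.
transitivity (det2 (p b) (p b + n b)); first by rewrite /det2 !mxE; ring.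
by rewrite -bE.
Qed.

Let bdet' : det2 b (n b) = 1.
Proof.
transitivity (det2 (p b + n b) (n b)); first by rewrite -bE.
by rewrite -det_pn /det2 !mxE; ring.
Qed.

Let next_b u : u \in V -> (n u == b) = (u == p b).
Proof. by move=> uV; apply/eqP/eqP => [<-|->]; [rewrite nK|rewrite pK]. Qed.

Let prev_b u : u \in V -> (p u == b) = (u == n b).
Proof. by move=> uV; apply/eqP/eqP => [<-|->]; [rewrite pK|rewrite nK]. Qed.

(** Only the new edge needs an argument. Since b = p b + n b, the functionals of the two removed
    edges at z are [det2 z (n b)] and [det2 (p b) z]; both are at most 0, and the new functional is
    their sum. *)
Lemma blowdown_ngon : ngon V' n' p'.
Proof.
split.
- by rewrite rem_uniq ?(ngon_uniq VP).
- by apply/eqP => e; have := mem_V' (p b); rewrite e pbb Vp.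
- move=> u; rewrite !mem_V' /n' => /andP[ub uV]; case: ifP => [_|/negbT upb].
    by rewrite nbb Vn.
  by rewrite next_b // upb Vn.
- move=> u; rewrite !mem_V' /p' => /andP[ub uV]; case: ifP => [_|/negbT unb].
    by rewrite pbb Vp.
  by rewrite prev_b // unb Vp.
- move=> u; rewrite mem_V' /n' /p' => /andP[ub uV].
  have [->|upb] := eqVneq u (p b); first by rewrite eqxx.
  rewrite nK //; case: eqP => // /(next_inj VP uV bV) e.
  by rewrite e eqxx in ub.
- move=> u; rewrite mem_V' /n' /p' => /andP[ub uV].
  have [->|unb] := eqVneq u (n b); first by rewrite eqxx.
  rewrite pK //; case: eqP => // e.
  by move: ub; rewrite -(pK uV) e pK // eqxx.
- move=> u; rewrite mem_V' /n' => /andP[ub uV].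
  by case: eqP => [->|_]; [rewrite det_pn|exact: ngon_det VP _ uV].
- move=> u z; rewrite !mem_V' /n' => /andP[ub uV] /andP[zb zV].
  have [->|_] := eqVneq u (p b); last by move=> zu zn; exact: (ngon_supp VP uV zV zu zn).
  move=> zp zn; rewrite det_pn.
  have h1 := ngon_supp VP (Vp bV) zV; rewrite pK // in h1.
  have h2 := ngon_supp VP bV zV.
  have {h1} := h1 zp zb; have {h2} := h2 zb zn; rewrite bdet bdet'.
  have -> : det2 z b = det2 z (p b) + det2 z (n b).
    by rewrite [in LHS]bE /det2 !mxE; ring.
  have -> : det2 b z = det2 (p b) z + det2 (n b) z.
    by rewrite [in LHS]bE /det2 !mxE; ring.
  by rewrite (det2C z (p b)) (det2C (n b) z); clear; lia.
Qed.

Let V'P := blowdown_ngon.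

Lemma blowdown_LDP : LDP_polygon (@conv R V').
Proof.
by apply: (ngon_LDP R V'P) => u; rewrite mem_V' => /andP[_]; exact: Vprim.
Qed.

Lemma blowdown_fixed : fixed_points (@conv R V') (p b, n b).
Proof.
rewrite (fixed_pointsE R V'P); exists (p b); first by rewrite /= mem_V' pbb Vp.
by rewrite /n' eqxx.
Qed.

Lemma blowdown_fan :
  fan_of (@conv R V) = blowup_fan (fan_of (conv V')) (p b) (n b).
Proof.
have d1 : 0 < det2 (p b) (n b) by rewrite det_pn.
have ray_neq (u : 'cV[int]_2) : cone_over (conv [:: u]) <> cone_over (@conv R [:: p b; n b]).
  by move=> e; apply: (cone2_neq_flat d1 _ (esym e)) => x y; exact: cone1_flat.
have zero_neq : [set 0] <> cone_over (@conv R [:: p b; n b]).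
  by move=> e; apply: (cone2_neq_flat d1 _ (esym e)) => x y -> ->; rewrite /rdet; ring.
rewrite /blowup_fan -bE; apply/seteqP; split=> tau.
  move=> /(fan_ofP VP)[[u uV ->]|[u uV ->]|->].
  - have [->|ub] := eqVneq u b; first by right; left; right.
    have [->|upb] := eqVneq u (p b); first by right; left; left; rewrite pK.
    left; split.
      apply/(fan_ofP V'P); constructor 1; exists u; first by rewrite mem_V' ub.
      by rewrite /n' (negPf upb).
    (* A cone of [V] equal to the one blown up would start at [p b], a case already treated. *)
    move=> /cone2_inj-/(_ (Vprim uV) (Vprim (Vn uV)) (Vprim (Vp bV)) (Vprim (Vn bV))).
    by case/(_ (ngon_det VP uV) d1) => e _; rewrite e eqxx in upb.
  - have [->|ub] := eqVneq u b; first by right; right.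
    left; split; last exact: ray_neq.
    by apply/(fan_ofP V'P); constructor 2; exists u; rewrite ?mem_V' ?ub.
  - by left; split => //; apply/(fan_ofP V'P); constructor 3.
move=> [[/(fan_ofP V'P)[[u + E]|[u + E]|->] ne]|[[->|->]|->]].
- rewrite mem_V' => /andP[ub uV]; apply/(fan_ofP VP); constructor 1; exists u => //.
  have [e|upb] := eqVneq u (p b); first by case: ne; rewrite E e /n' eqxx.
  by rewrite E /n' (negPf upb).
- by rewrite mem_V' => /andP[ub uV]; apply/(fan_ofP VP); constructor 2; exists u.
- by apply/(fan_ofP VP); constructor 3.
- by apply/(fan_ofP VP); constructor 1; exists (p b); [exact: Vp|rewrite pK].
- by apply/(fan_ofP VP); constructor 1; exists b.
- by apply/(fan_ofP VP); constructor 2; exists b.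
Qed.

Lemma blowdown_ex : exists (Q' : set 'cV[R]_2) v w,
  [/\ LDP_polygon Q',
      nb_singular_points Q' = nb_singular_points (@conv R V) /\
        picard_number Q' = (picard_number (@conv R V)).-1,
      fixed_points Q' (v, w), det2 v w = 1
    & toric_isom (fan_of (@conv R V)) (blowup_fan (fan_of Q') v w)].
Proof.
exists (conv V'), (p b), (n b); split.
- exact: blowdown_LDP.
- split.
    rewrite /nb_singular_points (singular_pointsE_fan R VP) // blowdown_fan.
    rewrite singular_cones_blowup ?det_pn // -(singular_pointsE_fan R V'P) //.
    by move=> u; rewrite mem_V' => /andP[_]; exact: Vprim.
  by rewrite (picard_numberE R VP) (picard_numberE R V'P) /V' size_rem // -!subn1 subnAC.
- exact: blowdown_fixed.
- exact: det_pn.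
- exists 1%:M; first by left; rewrite det1.
  by rewrite -blowdown_fan lin_image1 image_id.
Qed.

End Blowdown.

(** * Pentagons given by their five vertices *)

Section Pentagon.
Variables a b c d e : 'cV[int]_2.
Local Notation l := [:: a; b; c; d; e].
Local Notation below x y u := (det2 u y + det2 x u < det2 x y).

Lemma next5 : uniq l -> [/\ next l a = b, next l b = c, next l c = d, next l d = e & next l e = a].
Proof.
move=> U.
have nE i : (i < 5)%N -> next l (nth a l i) = nth a [:: b; c; d; e] i.
  by move=> i5; rewrite next_nth mem_nth // index_uniq.
by split; [exact: (nE 0%N)|exact: (nE 1%N)|exact: (nE 2)|exact: (nE 3)|exact: (nE 4)].
Qed.

Lemma ngon5 :
  [/\ 0 < det2 a b, 0 < det2 b c, 0 < det2 c d, 0 < det2 d e & 0 < det2 e a] ->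
  [/\ below a b c, below a b d & below a b e] ->
  [/\ below b c a, below b c d & below b c e] ->
  [/\ below c d a, below c d b & below c d e] ->
  [/\ below d e a, below d e b & below d e c] ->
  [/\ below e a b, below e a c & below e a d] ->
  uniq l /\ ngon l (next l) (prev l).
Proof.
move=> [ab bc cd de ea] [abc abd abe] [bca bcd bce] [cda cdb cde] [dea deb dec] [eab eac ead].
have dneq x y : 0 < det2 x y -> x != y.
  by apply: contraTneq => ->; rewrite det2vv.
have bneq x y u : below x y u -> x != u.
  by apply: contraTneq => ->; rewrite det2vv addr0 ltxx.
have U : uniq l.
  rewrite /= !inE !negb_or (dneq a b) // (bneq a b c) // (bneq a b d) //.
  rewrite [a == e]eq_sym (dneq e a) // (dneq b c) // (bneq b c d) // (bneq b c e) //.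
  by rewrite (dneq c d) // (bneq c d e) // (dneq d e).
have [na nb nc nd ne] := next5 U.
split=> //; split=> //.
- by move=> v; rewrite mem_next.
- by move=> v; rewrite mem_prev.
- by move=> v _; exact: prev_next.
- by move=> v _; exact: next_prev.
- by move=> v; rewrite !inE => /or4P[|||/orP[]] /eqP ->; rewrite ?na ?nb ?nc ?nd ?ne.
- move=> v u; rewrite !inE => /or4P[|||/orP[]] /eqP ->;
    rewrite ?na ?nb ?nc ?nd ?ne;
    by move=> /or4P[|||/orP[]] /eqP ->; rewrite ?eqxx.
Qed.

End Pentagon.

(** The adjugate of the matrix with columns [v] and [w]; when their determinant is 1, it sends them
    to the standard basis. *)
Definition frame v w : 'M[int]_2 := \matrix_(i < 2, j < 2)
  if i == ord0 then (if j == ord0 then Y w else - X w)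
  else (if j == ord0 then - Y v else X v).

Lemma frame_mul v w u : frame v w *m u = vec2 (det2 u w) (det2 v u).
Proof. by apply: col2P; rewrite mul_row_col2 !mxE /= /det2; ring. Qed.

Lemma det_frame v w : \det (frame v w) = det2 v w.
Proof. by rewrite det_mx2 !mxE /= /det2; ring. Qed.

Lemma primitive_vec2 x y : primitive (vec2 x y) <-> gcdz x y = 1.
Proof. by rewrite /primitive !vec2E. Qed.

(** The edges have determinants 1, 1, -r - p q, q t - r s and -t, and the bounds make the last three
    at least 2. *)
Lemma pentagon_nb_singular (R : realType) (p q r s t : int) : p <= 1 ->
  r <= -1 -> r <= - p * q - 2 -> r <= q - p * q - 1 ->
  r <= - p * q + q * t - r * s + p * s + t - 1 ->
  t <= -2 -> t <= - s - 1 -> t <= q * t - r * s + r - 1 -> 2 <= q * t - r * s ->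
  nb_singular_points
    (@conv R [:: vec2 1 0; vec2 0 1; vec2 (-1) p; vec2 q r; vec2 s t]) = 3%N.
Proof.
move=> p1 r1 k3 k4 l4 t2 st l5 d2.
have [h1 h2 h3 h4 h5] := pentagon_opposite_int p1 r1 k3 k4 l4 t2 st l5 d2.
set A := vec2 1 0; set B := vec2 0 1; set C := vec2 (-1) p; set D := vec2 q r.
set E := vec2 s t.
have dAB : det2 A B = 1 by rewrite /det2 !vec2E; ring.
have dBC : det2 B C = 1 by rewrite /det2 !vec2E; ring.
have dCD : det2 C D = - r - p * q by rewrite /det2 !vec2E; ring.
have dDE : det2 D E = q * t - r * s by rewrite /det2 !vec2E.
have dEA : det2 E A = - t by rewrite /det2 !vec2E; ring.
have dAC : det2 A C = p by rewrite /det2 !vec2E; ring.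
have dAD : det2 A D = r by rewrite /det2 !vec2E; ring.
have dBD : det2 B D = - q by rewrite /det2 !vec2E; ring.
have dBE : det2 B E = - s by rewrite /det2 !vec2E; ring.
have dCE : det2 C E = - t - p * s by rewrite /det2 !vec2E; ring.
have dE := (dAB, dBC, dCD, dDE, dEA, dAC, dAD, dBD, dBE, dCE).
have [U VP] : uniq [:: A; B; C; D; E] /\ ngon [:: A; B; C; D; E]
    (next [:: A; B; C; D; E]) (prev [:: A; B; C; D; E]).
  apply: ngon5; split; rewrite ?dE;
    rewrite ?(det2C A E) ?(det2C B A) ?(det2C C B) ?(det2C D C) ?(det2C E D)
      ?(det2C C A) ?(det2C D A) ?(det2C D B) ?(det2C E B) ?(det2C E C) ?dE;
    clearbody A B C D E; clear -p1 r1 k3 k4 l4 t2 st l5 d2 h1 h2 h3 h4 h5; lia.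
move: VP (next5 U); move: (next _) => nx VP [na nb nc nd ne].
rewrite (nb_singular_pointsE R VP) /= na nb nc nd ne !dE; have -> : 2 <= - r - p * q by lia.
have -> : 2 <= - t by lia.
by rewrite d2.
Qed.

(** The frame of the first smooth edge provides the coordinates, and smoothness of the second gives
    the third vertex first coordinate -1. The bounds express that the other edges are singular and
    that the corners are convex, sharpened by primitivity. *)
Lemma pentagon_ex (R : realType) V n p : ngon V n p -> {in V, forall v, primitive v} ->
  size V = 5%N -> forall v, v \in V -> det2 v (n v) = 1 -> det2 (n v) (n (n v)) = 1 ->
  (forall w, w \in V -> det2 w (n w) == 1 -> w \in [:: v; n v]) ->
  exists p q r s t : int,
         [/\ p <= 1,
             r <= Num.min (-1)
                   (Num.min (- p * q - 2)
                     (Num.min (q - p * q - 1)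
                       (- p * q + q * t - r * s + p * s + t - 1))),
             t <= Num.min (-2) (Num.min (- s - 1) (q * t - r * s + r - 1)),
             2 <= q * t - r * s
           & [/\ gcdz q r = 1, gcdz s t = 1
               & equivalent (@conv R V)
                   (conv [:: vec2 1 0; vec2 0 1; vec2 (-1) p;
                             vec2 q r; vec2 s t])]].
Proof.
move=> VP Vprim V5 v v1 s1 s2 run.
have Vn := ngon_next VP; have := traject_next_uniq VP R v1 (eq_leq (esym V5)).
have := iter_next_size VP R v1; have := traject_next_perm VP R v1; rewrite V5 /=.
move def2 : (n v) => v2; move def3 : (n v2) => v3; move def4 : (n v3) => v4.
move def5 : (n v4) => v5; rewrite def2 in s1 s2 run; rewrite def3 in s2.
move=> perm5 def1 /andP[n1 /andP[n2 /andP[n3 /andP[n4 _]]]].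
move: n1 n2 n3 n4; rewrite !inE !negb_or.
move=> /and4P[n12 n13 n14 n15] /and3P[n23 n24 n25] /andP[n34 n35] n45.
have V2 : v2 \in V by rewrite -def2 Vn.
have V3 : v3 \in V by rewrite -def3 Vn.
have V4 : v4 \in V by rewrite -def4 Vn.
have V5' : v5 \in V by rewrite -def5 Vn.
have coord u z := det2_coord u z s1.
have sing w : w \in V -> w != v -> w != v2 -> 2 <= det2 w (n w).
  move=> wV wv wv2; rewrite -(not_smooth VP) //; apply/negP => /run-/(_ wV).
  by rewrite !inE (negPf wv) (negPf wv2).
have c3 : det2 v3 v2 = -1 by rewrite det2C s2.
have c1 := det2vv v2; have c0 := det2vv v.
have supp w u : w \in V -> u \in V -> u != w -> u != n w ->
    det2 u (n w) + det2 w u < det2 w (n w) by exact: (ngon_supp VP).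
have k12 u : u \in V -> u != v -> u != v2 -> det2 u v2 + det2 v u <= 0.
  by move=> uV uv u2; have := supp v u v1 uV uv; rewrite def2 s1 => /(_ u2); clear; lia.
have h3 := k12 v3 V3; have h4 := k12 v4 V4; have h5 := k12 v5 V5'.
have k23 := supp v2 v4 V2 V4.
have k34 := supp v3 v5 V3 V5'.
have k45 := supp v4 v V4 v1.
have d3 := sing v3 V3; have d4 := sing v4 V4; have d5 := sing v5 V5'.
rewrite ![_ == v]eq_sym ![_ == v2]eq_sym in h3 h4 h5 d3 d4 d5.
rewrite def3 s2 eq_sym n24 eq_sym n34 in k23.
rewrite def4 eq_sym n35 eq_sym n45 in k34.
rewrite def5 n14 n15 in k45.
rewrite n13 n23 in h3 d3; rewrite n14 n24 in h4 d4; rewrite n15 n25 in h5 d5.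
have {}h3 := h3 isT isT; have {}h4 := h4 isT isT; have {}h5 := h5 isT isT.
have {}d3 := d3 isT isT; have {}d4 := d4 isT isT; have {}d5 := d5 isT isT.
have {}k23 := k23 isT isT; have {}k34 := k34 isT isT; have {}k45 := k45 isT isT.
rewrite def4 in d3; rewrite def5 in d4; rewrite def1 in d5.
rewrite c3 in h3; rewrite det2C in d5.
rewrite coord c3 (det2C v2 v4) in k23.
rewrite (coord v5) (coord v3) (coord v3 v4) c3 in k34.
rewrite (coord v4 v5) (det2C v4 v) in k45.
rewrite (coord v3) c3 in d3; rewrite (coord v4) in d4.
have g4 : gcdz (det2 v4 v2) (det2 v v4) = 1.
  apply/primitive_vec2; rewrite -frame_mul; apply: primitive_mul; last exact: Vprim.
  by left; rewrite det_frame.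
have g5 : gcdz (det2 v5 v2) (det2 v v5) = 1.
  apply/primitive_vec2; rewrite -frame_mul; apply: primitive_mul; last exact: Vprim.
  by left; rewrite det_frame.
exists (det2 v v3), (det2 v4 v2), (det2 v v4), (det2 v5 v2), (det2 v v5).
move: h3 h4 h5 d3 d4 d5 k23 k34 k45 g4 g5.
(* Settled first and replaced by True, so that only arithmetic in five generalised integers
   remains. *)
have -> : equivalent (@conv R V) (conv [:: vec2 1 0; vec2 0 1; vec2 (-1) (det2 v v3);
     vec2 (det2 v4 v2) (det2 v v4); vec2 (det2 v5 v2) (det2 v v5)]) = True.
  apply/propext; split=> // _; exists (frame v v2); first by left; rewrite det_frame.
  have -> : @conv R V = conv [:: v; v2; v3; v4; v5].
    by apply/seteqP; split; apply: sub_conv => u; rewrite perm5.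
  rewrite lin_image_conv; last by left; rewrite det_frame.
  by rewrite /= !frame_mul s1 c0 c1 c3.
move: (det2 v v3) (det2 v4 v2) (det2 v v4) (det2 v5 v2) (det2 v v5).
clear => p q r s t h3 h4 h5 d3 d4 d5 k23 k34 k45 g4 g5.
have [i1 i2 i3] : [/\ r <= -1, r <= q - p * q - 1 & t <= - s - 1].
  by apply: pentagon_normal_int => //; lia.
split=> //; try by rewrite !le_min; lia.
lia.
Qed.

Unset Implicit Arguments.

Theorem theorem3 (R : realType) (Q : set 'cV[R]_2) (hQ : LDP_polygon Q) :
  (nb_singular_points Q = 3%N <->
   [\/ (* (1) *)
       nb_singular_points Q = 3%N /\ (picard_number Q <= 2)%N,
       (* (2) *)
       exists p q r s t : int,
         [/\ p <= 1,
             r <= Num.min (-1)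
                   (Num.min (- p * q - 2)
                     (Num.min (q - p * q - 1)
                       (- p * q + q * t - r * s + p * s + t - 1))),
             t <= Num.min (-2) (Num.min (- s - 1) (q * t - r * s + r - 1)),
             2 <= q * t - r * s
           & [/\ gcdz q r = 1, gcdz s t = 1
               & equivalent Q
                   (conv [:: vec2 1 0; vec2 0 1; vec2 (-1) p;
                             vec2 q r; vec2 s t])]]
     | (* (3) *)
       exists (Q' : set 'cV[R]_2) (v w : 'cV[int]_2),
         [/\ LDP_polygon Q',
             nb_singular_points Q' = 3%N /\ picard_number Q' = 3%N,
             fixed_points Q' (v, w), det2 v w = 1
           & toric_isom (fan_of Q) (blowup_fan (fan_of Q') v w)]])
  /\ (nb_singular_points Q = 3%N -> (picard_number Q <= 4)%N).
Proof.
have [V [n [p [VP QE Vprim]]]] := LDP_ngon hQ.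
have Vfin : finite_set (singular_points Q).
  by rewrite QE (singular_pointsE R VP); exact/finite_image/finite_seq.
have nbE := nb_singular_pointsE R VP; have picE := picard_numberE R VP.
split; last first.
  rewrite QE nbE picE => V3; rewrite leq_subLR leqNgt; apply/negP => V7.
  have [|v [_ _ _ _ [[V5 _]|[V6 _]]]] := three_singular VP Vprim R _ V3.
  - by apply: leq_trans V7.
  - by rewrite V5 in V7.
  - by rewrite V6 in V7.
(* Alternative (1) carries the count itself: a Picard number of at most two does not determine it,
   as the projective plane shows. *)
split=> [nb3|[[]//|[p0 [q [r [s [t [p1 + + d2 [_ _ [M uM ME]]]]]]]]|]].
- rewrite QE nbE in nb3.
  have [V4|V5] := leqP (size V) 4.
    by constructor 1; rewrite QE nbE picE; split=> //; rewrite leq_subLR.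
  have [v [vV /eqP s1 /eqP s2 spv [[V5' run]|[V6 s3]]]] := three_singular VP Vprim R V5 nb3.
    by constructor 2; rewrite QE; exact: (pentagon_ex R VP Vprim V5' vV s1 s2 run).
  constructor 3; rewrite QE.
  have pV := ngon_prev VP vV; have nV := ngon_next VP vV.
  have nnV := ngon_next VP nV.
  have n3 : iter 3 n v != v by apply: (iter_next_neq VP R) => //; rewrite V6.
  have n4 : n (n (n v)) != p v.
    apply/eqP => e; have : iter 4 n v = v by rewrite /= e (ngon_prevK VP).
    by apply/eqP; apply: (iter_next_neq VP R) => //; rewrite V6.
  (* Either common vertex of the three smooth edges may be the removable one, hence a statement for
     any [b]. *)
  have blow b : b \in V -> b = p b + n b -> det2 (p b) b = 1 ->
      exists (Q' : set 'cV[R]_2) (v w : 'cV[int]_2),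
       [/\ LDP_polygon Q', nb_singular_points Q' = 3%N /\ picard_number Q' = 3%N,
           fixed_points Q' (v, w), det2 v w = 1
         & toric_isom (fan_of (@conv R V)) (blowup_fan (fan_of Q') v w)].
    move=> bV bE bd; have [Q' [x [y [? [nbQ' picQ'] ? ? ?]]]] := blowdown_ex R VP Vprim bV bE bd.
    by exists Q', x, y; split=> //; rewrite nbQ' picQ' nbE picE nb3 V6.
  have [e|e] := smooth_chain VP Vprim vV (introT eqP s1) (introT eqP s2) s3 spv n3 n4.
    by apply: (blow (n v)); rewrite ?(ngon_nextK VP).
  by apply: (blow (n (n v))); rewrite ?(ngon_nextK VP).
- rewrite !le_min => /and4P[r1 k3 k4 l4] /and3P[t2 st l5].
  rewrite -(nb_singular_points_lin uM Vfin) ME.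
  exact: pentagon_nb_singular.
(* The isomorphism relates fans and not polygons, so the counts are compared through
   [singular_cones]. *)
- move=> [Q' [v [w [hQ' [nb3 _] _ d1 [M uM ME]]]]].
  have [V' [n' [p' [VP' QE' Vprim']]]] := LDP_ngon hQ'.
  rewrite /nb_singular_points in nb3 *.
  have SE : singular_points Q = singular_cones (fan_of Q).
    by rewrite QE (singular_pointsE_fan R VP).
  rewrite SE in Vfin *; rewrite -(card_singular_cones_lin uM Vfin) ME.
  by rewrite singular_cones_blowup // QE' -(singular_pointsE_fan R VP') // -QE'.
Qed.
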